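(* Let $p\in[1,\infty)$, and let $(X_i,d_i,e_i)_{i\in\mathbb N}$ be a sequence of pointed metric spaces with metric ultralimit $(\hat X,\hat d)$. Let $\mu$ be a Radon measure on $\hat X$, with $\mu\in\mathcal P_p(\hat X)$. Then there exists a Loeb measure $\mu_L$ on $X^\omega_{\lim}$ whose $st_{\hat d}$-pushforward is $\mu$. Moreover, we can take $\mu_L$ to be the Loeb measure associated to a lifting $\mu^\omega$ of $\mu$ which is hyperfinite (i.e. $\mu^\omega$ is an ultraproduct of discrete measures).
   Context: Fix a non-principal ultrafilter $\omega$ on $\mathbb N$. A property holds $\omega$-a.s. if the set of indices for which it holds belongs to $\omega$. $X^\omega=\prod_i X_i/\sim_\omega$ is the ultraproduct, classes written $[(x_i)]$; $\mathbb R^\omega$ is the ultrapower of $\mathbb R$; $a\approx b$ means $|a-b|<\varepsilon$ for every standard real $\varepsilon>0$; $st(a)$ is the real $r$ with $a\approx r$ (if $a$ is finite). Metric ultralimit: $d^\omega([(x_i)],[(y_i)])=[(d_i(x_i,y_i))]$, $e^\omega=[(e_i)]$, $X^\omega_{\lim}=\{x\in X^\omega:d^\omega(e^\omega,x)\text{ is finite}\}$; $\hat X$ is the quotient of $X^\omega_{\lim}$ by $d^\omega(x,y)\approx0$, with metric $\hat d$ induced by $st(d^\omega)$ and quotient map $st_{\hat d}:X^\omega_{\lim}\to\hat X$. For a metric space $Y$, $\mathcal P_p(Y)$ is the set of Radon probability measures on $Y$ with finite $p$th moment, and $W_p(\mu,\nu)=\inf_{\gamma\in\Pi(\mu,\nu)}\left(\int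 d(x,y)^p\,d\gamma\right)^{1/p}$, with $\Pi(\mu,\nu)$ the couplings. $(\widehat{\mathcal P_p(X)},\hat W_p)$ is the metric ultralimit of $(\mathcal P_p(X_i),W_p,\delta_{e_i})$, with quotient map $st_{\hat W_p}:\mathcal P_p(X)^\omega_{\lim}\to\widehat{\mathcal P_p(X)}$. The map $\iota:\mathcal P_p(\hat X)\to\widehat{\mathcal P_p(X)}$ is the isometric embedding given, for $\hat x_j=st_{\hat d}[(x_{j,i})_i]$, by $\iota\left(\frac1N\sum_{j=1}^N\delta_{\hat x_j}\right)=st_{\hat W_p}\left[\left(\frac1N\sum_{j=1}^N\delta_{x_{j,i}}\right)_{i}\right]$ and extended to $\mathcal P_p(\hat X)$ by density. A lifting of $\mu\in\mathcal P_p(\hat X)$ is a $\mu^\omega\in\mathcal P_p(X)^\omega_{\lim}$ with $st_{\hat W_p}(\mu^\omega)=\iota\mu$. Loeb measures: $\mathcal B^\omega$ is the algebra of internal Borel sets $B^\omega=[(B_i)]=\{[(x_i)]:x_i\in B_i\ \omega\text{-a.s.}\}$, $B_i\subseteq X_i$ Borel. For an internal probability measure $\mu^\omega=[(\mu_i)]$ put $\mu^\omega(B^\omega)=[(\mu_i(B_i))]$. Then $st\circ\mu^\omega$ is a premeasure on $\mathcal B^\omega$, and its (complete) Carathéodory extension $\mu_L=\mathrm{Loeb}(\mu^\omega)$ is the Loeb measure associated to $\mu^\omega$. It is a Loeb measure on $X^\omega_{\lim}$ if $\mu_L(X^\omega\setminus X^\omega_{\lim})=0$. Its $st_{\hat d}$-pushforward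 is $\mu_L\circ st_{\hat d}^{-1}$, well-defined when $st_{\hat d}^{-1}(B)$ is $\mu_L$-measurable for every Borel $B\subseteq\hat X$. *)

(* Defs.v *)
From HB Require Import structures.
From mathcomp Require Import all_boot all_order all_algebra.
From mathcomp Require Import all_classical all_reals all_analysis.
From mathcomp Require Import measurable_realfun.
From mathcomp Require Import lra.

Set Implicit Arguments.
Unset Strict Implicit.
Unset Printing Implicit Defensive.

Import Order.TTheory GRing.Theory Num.Theory.
Import numFieldNormedType.Exports.

Local Open Scope classical_set_scope.
Local Open Scope ring_scope.

#[short(type="pointedMetricType")]
HB.structure Definition PointedMetric (R : numDomainType) :=
  {T of Metric R T & Pointed T}.

Record free_ultrafilter := FreeUltrafilter {
  ultra_sets : set_system nat ;
  ultra_setsP : UltraFilter ultra_sets ;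
  ultra_free : forall n, ~ ultra_sets [set n] }.
#[global] Existing Instance ultra_setsP.

(* Set-theoretic quotient: the set of all classes [set y | E x y].  Unlike
   generic_quotient it does not ask for a proof that E is an equivalence
   relation; this is used for E x y := (Wp(x, y) infinitesimal), where
   transitivity is the triangle inequality for the Wasserstein distance. *)
Section quotient.
Context {T : Type} (E : T -> T -> Prop).

Record quot := Quot {
  qset :> set T ;
  qsetP : exists x, qset = [set y | E x y] }.

Definition qclass (x : T) : quot :=
  @Quot [set y | E x y] (ex_intro _ x erefl).

Definition qrepr (q : quot) : T := sval (cid (qsetP q)).

HB.instance Definition _ := gen_eqMixin quot.
HB.instance Definition _ := gen_choiceMixin quot.

Lemma quot_eq (p q : quot) : qset p = qset q -> p = q.
Proof.
case: p q => [C CP] [D DP] /= CD; rewrite -CD in DP *.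
by congr Quot; exact: Prop_irrelevance.
Qed.

Lemma qreprK q : qclass (qrepr q) = q.
Proof. by apply: quot_eq; rewrite /= /qrepr; case: cid => x /= ->. Qed.

Lemma qclassP x y :
  (forall x, E x x) -> (forall x y, E x y -> E y x) ->
  (forall y x z, E x y -> E y z -> E x z) ->
  qclass x = qclass y <-> E x y.
Proof.
move=> Exx Esym Etrans; split=> [[Exy]|Exy].
  have : [set z | E y z] y by exact: Exx.
  by rewrite -Exy.
apply: quot_eq; apply/seteqP; split => z /=; apply: Etrans => //.
exact: Esym.
Qed.

End quotient.

Section ultraproduct.
Context (omega : free_ultrafilter).

Definition as_eq (X : nat -> Type) (x y : forall i, X i) : Prop :=
  ultra_sets omega [set i | x i = y i].

Definition ultraproduct (X : nat -> Type) := quot (@as_eq X).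

Definition uclass (X : nat -> Type) (x : forall i, X i) : ultraproduct X :=
  qclass (@as_eq X) x.

Definition urepr (X : nat -> Type) (x : ultraproduct X) : forall i, X i :=
  qrepr x.

Lemma uclassP X (x y : forall i, X i) :
  uclass x = uclass y <-> ultra_sets omega [set i | x i = y i].
Proof.
apply: qclassP.
- by move=> u; apply: filterS filterT => i _ /=.
- by move=> u v; apply: filterS => i /=.
- move=> v u w uv vw; apply: filterS (filterI uv vw) => i /= [-> ->] //.
Qed.

Lemma ureprK X (x : ultraproduct X) : uclass (urepr x) = x.
Proof. exact: qreprK. Qed.

Lemma urepr_class X (x : forall i, X i) :
  ultra_sets omega [set i | urepr (uclass x) i = x i].
Proof. by apply/uclassP; rewrite ureprK. Qed.

End ultraproduct.

(* On the ultrapower of the reals, the relations and operations are the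
   coordinatewise ones, computed on representatives. *)
Section hyperreals.
Context {R : realType} (omega : free_ultrafilter).

Definition hyperreal := ultraproduct omega (fun=> R).

Definition hstd (r : R) : hyperreal := uclass omega (fun=> r).

Definition hclose (a b : hyperreal) : Prop := forall eps : R, 0 < eps ->
  ultra_sets omega [set i | `|urepr a i - urepr b i| < eps].

Definition hfinite (a : hyperreal) : Prop :=
  exists r : R, ultra_sets omega [set i | `|urepr a i| <= r].

Definition hst (a : hyperreal) : R := xget 0 [set r | hclose a (hstd r)].

End hyperreals.

Section hyperreal_lemmas.
Context {R : realType} {omega : free_ultrafilter}.
Implicit Types (a b : hyperreal (R := R) omega) (u v : nat -> R).

Lemma hclose_class u v : hclose (uclass omega u) (uclass omega v) <->
  forall eps : R, 0 < eps -> ultra_sets omega [set i | `|u i - v i| < eps].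
Proof.
have ur := urepr_class omega u; have vr := urepr_class omega v.
split=> uv eps e0; apply: filterS (filterI (filterI ur vr) (uv _ e0)) => i /=.
  by move=> [[-> ->]].
by move=> [[-> ->]].
Qed.

Lemma hclose_cvg u (r : R) :
  hclose (uclass omega u) (hstd omega r) <-> u @ ultra_sets omega --> r.
Proof.
split=> [/hclose_class ur|ur].
  by apply/cvgrPdistC_lt => e e0; exact: ur.
by apply/hclose_class => e e0; move/cvgrPdistC_lt: ur; exact.
Qed.

Lemma hst_cvg u (r : R) :
  u @ ultra_sets omega --> r -> hst (uclass omega u) = r.
Proof.
move=> ur; rewrite /hst; apply: xget_unique => [|s].
  exact/hclose_cvg.
by move=> /hclose_cvg us; apply: (cvg_unique _ us ur).
Qed.

Lemma hfinite_class u : hfinite (uclass omega u) <->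
  exists r : R, ultra_sets omega [set i | `|u i| <= r].
Proof.
have ur := urepr_class omega u.
by split=> -[r rP]; exists r; apply: filterS (filterI ur rP) => i /= [->].
Qed.

Lemma bounded_cvg u (M : R) : ultra_sets omega [set i | `|u i| <= M] ->
  exists r : R, u @ ultra_sets omega --> r.
Proof.
move=> uM.
have UF : UltraFilter (u @ ultra_sets omega).
  split; first exact: fmap_proper_filter.
  move=> G GF uG; apply/seteqP; split=> // A GA.
  have [//|oA] := in_ultra_setVsetC (u @^-1` A) (ultra_setsP omega).
  exfalso; have : G (~` A) by apply: uG.
  by move=> /(filterI GA); rewrite setICr => /filter_not_empty.
have := @segment_compact R (- M) M.
rewrite compact_ultra => /(_ _ UF) [|r [_ ur]].
  by apply: filterS uM => i /=; rewrite in_itv /= ler_norml.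
by exists r.
Qed.

Lemma hst_class_cvg u : hfinite (uclass omega u) ->
  u @ ultra_sets omega --> hst (uclass omega u).
Proof.
by move=> /hfinite_class[M /bounded_cvg[r ur]]; rewrite (hst_cvg ur).
Qed.

Lemma ultra_le_cvg u v (r s : R) :
  u @ ultra_sets omega --> r -> v @ ultra_sets omega --> s ->
  ultra_sets omega [set i | u i <= v i] -> r <= s.
Proof.
move=> ur vs uv; rewrite -subr_ge0.
have vur : v i - u i @[i --> ultra_sets omega] --> s - r by exact: cvgB.
apply: (closed_cvg (>= (0 : R)) (@closed_ge R 0) _ _ vur).
by apply: filterS uv => i /=; rewrite subr_ge0.
Qed.

End hyperreal_lemmas.

(* The metric ultralimit of the (T i, d i, e i).  Nothing is assumed of d i, so
   that the construction applies both to metricTypes and to spaces of measures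
   with the Wasserstein distance. *)
Section ultralimit.
Context {R : realType} (omega : free_ultrafilter).
Context {T : nat -> Type} (d : forall i, T i -> T i -> R) (e : forall i, T i).

Definition udist (x y : ultraproduct omega T) : hyperreal (R := R) omega :=
  uclass omega (fun i => d (urepr x i) (urepr y i)).

Definition in_lim (x : ultraproduct omega T) : Prop :=
  hfinite (udist (uclass omega e) x).

Definition ulim := {x : ultraproduct omega T | in_lim x}.

Definition ulim_near (x y : ulim) : Prop :=
  hclose (udist (sval x) (sval y)) (hstd omega 0).

Definition ultralimit := quot ulim_near.

Definition ulim_st (x : ulim) : ultralimit := qclass ulim_near x.

Definition ultralimit_dist (x y : ultralimit) : R :=
  hst (udist (sval (qrepr x)) (sval (qrepr y))).

End ultralimit.

Section ultralimit_metric.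
Context {R : realType} (omega : free_ultrafilter).
Context (X : nat -> pointedMetricType R).

Definition uspace := ultraproduct omega (fun i => X i).

Let d i (x y : X i) : R := mdist x y.
Let e i : X i := point.

Definition uspace_lim : Type := ulim omega d e.

Definition hat : Type := @ultralimit R omega (fun i => X i) d e.

Definition st_hat (x : uspace_lim) : hat := ulim_st x.

Definition hat_dist (x y : hat) : R := ultralimit_dist x y.

Let dist (x y : uspace_lim) : nat -> R :=
  fun i => d (urepr (sval x) i) (urepr (sval y) i).

Let dist_finite x y : hfinite (uclass omega (dist x y)).
Proof.
case: x y => [x [r /= xr]] [y [s /= ys]].
apply/hfinite_class; exists (r + s).
have h1 := urepr_class omega
  (fun i => d (urepr (uclass omega e) i) (urepr x i)).
have h2 := urepr_class omega
  (fun i => d (urepr (uclass omega e) i) (urepr y i)).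
apply: filterS (filterI (filterI xr h1) (filterI ys h2)) => i [[+ h3] [+ h4]].
rewrite /udist /= h3 h4 /dist /d /= !ger0_norm ?mdist_ge0// => xri ysi.
apply: le_trans (metric_triangle _ (urepr (uclass omega e) i) _) _.
by rewrite lerD// metric_sym.
Qed.

Let dist_cvg x y :
  dist x y @ ultra_sets omega --> hst (uclass omega (dist x y)).
Proof. exact/hst_class_cvg/dist_finite. Qed.

Let nearP x y : ulim_near x y <-> dist x y @ ultra_sets omega --> (0 : R).
Proof. exact: hclose_cvg. Qed.

Let stxx x : hst (uclass omega (dist x x)) = 0.
Proof.
apply: hst_cvg; rewrite (_ : dist x x = fun=> 0); first exact: cvg_cst.
by apply/funext => i; rewrite /dist /d mdistxx.
Qed.

Let st_sym x y : hst (uclass omega (dist x y)) = hst (uclass omega (dist y x)).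
Proof.
by congr (hst (uclass _ _)); apply/funext => i; rewrite /dist /d metric_sym.
Qed.

Let st_triangle y x z : hst (uclass omega (dist x z)) <=
  hst (uclass omega (dist x y)) + hst (uclass omega (dist y z)).
Proof.
have xyz : dist x y i + dist y z i @[i --> ultra_sets omega] -->
    hst (uclass omega (dist x y)) + hst (uclass omega (dist y z)).
  by apply: cvgD; exact: dist_cvg.
apply: (ultra_le_cvg (@dist_cvg x z) xyz).
by apply: filterS filterT => i _; exact: metric_triangle.
Qed.

Let near_st x y : ulim_near x y <-> hst (uclass omega (dist x y)) = 0.
Proof.
split=> [/nearP/hst_cvg//|xy0]; apply/nearP; rewrite -xy0; exact: dist_cvg.
Qed.

Let st_ge0 x y : 0 <= hst (uclass omega (dist x y)).
Proof.
rewrite -(@pmulrn_lge0 _ _ 2)// -(stxx x).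
by rewrite (le_trans (st_triangle y _ _))// (st_sym y) mulr2n.
Qed.

Lemma st_hatP x y : st_hat x = st_hat y <-> ulim_near x y.
Proof.
apply: qclassP => [u|u v /near_st uv|v u w /near_st uv /near_st vw].
- exact/near_st.
- by apply/near_st; rewrite st_sym.
- apply/near_st/eqP; rewrite eq_le st_ge0 andbT.
  by rewrite (le_trans (st_triangle v _ _))// uv vw addr0.
Qed.

HB.instance Definition _ := Choice.on hat.

Let hat_distxx x : hat_dist x x = 0. Proof. exact: stxx. Qed.

Let hat_dist_eq0 x y : hat_dist x y = 0 -> x = y.
Proof. by move=> /near_st/st_hatP; rewrite /st_hat /ulim_st !qreprK. Qed.

Let hat_dist_sym x y : hat_dist x y = hat_dist y x. Proof. exact: st_sym. Qed.

Let hat_dist_triangle y x z : hat_dist x z <= hat_dist x y + hat_dist y z.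
Proof. exact: st_triangle. Qed.

HB.instance Definition _ := isMetric.Build R hat
  hat_distxx hat_dist_eq0 hat_dist_sym hat_dist_triangle.

Lemma base_in_lim : in_lim d e (uclass omega e).
Proof.
apply/hfinite_class; exists 0; apply: filterS filterT => i _ /=.
by rewrite /d mdistxx normr0.
Qed.

Definition base_lim : uspace_lim := exist _ (uclass omega e) base_in_lim.

HB.instance Definition _ := isPointed.Build hat (st_hat base_lim).

End ultralimit_metric.

Notation borel T := (g_sigma_algebraType (@open T%type)).

Section wasserstein.
Context {R : realType}.
Implicit Type X : pointedMetricType R.

(* Local finiteness is automatic for a probability measure. *)
Definition radon X (mu : probability (borel X) R) : Prop :=
  forall A : set (borel X), measurable A ->
    mu A = ereal_sup [set mu K | K in [set K : set X | compact K /\ K `<=` A]].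

Definition finite_moment X (p : R) (mu : probability (borel X) R) : Prop :=
  exists x0 : X, (\int[mu]_x (mdist x0 (x : X) `^ p)%:E < +oo)%E.

Record Pp (X : pointedMetricType R) (p : R) := MkPp {
  Pp_prob :> probability (borel X) R ;
  Pp_radon : radon Pp_prob ;
  Pp_moment : finite_moment p Pp_prob }.

(* The coupling lives on the Borel sigma-algebra of X * X, on which the distance
   is measurable even when X is not separable; it is Radon because its marginals
   are. *)
Definition coupling X (mu nu : probability (borel X) R)
    (gamma : probability (borel (X * X)) R) : Prop :=
  forall A : set (borel X), measurable A ->
    gamma (A `*` setT) = mu A /\ gamma (setT `*` A) = nu A.

Definition Wp X (p : R) (mu nu : Pp X p) : R :=
  fine (ereal_inf
    [set (\int[gamma]_z (mdist (z : X * X).1 z.2 `^ p)%:E) `^ p^-1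
      | gamma in coupling mu nu]%E).

Lemma measurable_mdist X (x0 : X) :
  measurable_fun setT (fun x : borel X => mdist x0 (x : X)).
Proof.
apply: (measurability _ (RGenInftyO.measurableE R)) => _ [_ [r ->] <-].
rewrite setTI; apply: sub_sigma_algebra; rewrite openE => y /=.
rewrite in_itv/= => x0y; rewrite /interior.
have e0 : 0 < r - mdist x0 y by rewrite subr_gt0.
apply: filterS (nbhsx_ballx y (r - mdist x0 y) e0) => z.
rewrite ballEmdist/= in_itv/= ltrBrDl; apply: le_lt_trans.
exact: metric_triangle.
Qed.

Lemma measurable_mdist2 X (p : R) :
  measurable_fun setT (fun z : borel (X * X) =>
    (mdist (z : X * X).1 z.2 `^ p)%:E).
Proof.
apply/measurable_EFinP/(measurableT_comp (measurable_powR p)).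
apply: (measurability _ (RGenInftyO.measurableE R)) => _ [_ [r ->] <-].
rewrite setTI; apply: sub_sigma_algebra; rewrite openE => -[y1 y2] /=.
rewrite in_itv/= => y12; rewrite /interior.
have e0 : 0 < (r - mdist y1 y2) / 2 by rewrite divr_gt0// subr_gt0.
apply: filterS (nbhsx_ballx (y1, y2) _ e0) => -[z1 z2] [/=].
rewrite !ballEmdist/= in_itv/= => yz1 yz2.
have := metric_triangle z1 y1 z2; have := metric_triangle y1 y2 z2.
by rewrite (metric_sym z1 y1); move: yz1 yz2; lra.
Qed.

(* A finite convex combination of Dirac masses; the weights sum to 1 because mu
   is a probability. *)
Definition discrete_measure X (mu : probability (borel X) R) : Prop :=
  exists (N : nat) (a : nat -> R) (x : nat -> X), (forall j, 0 <= a j) /\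
    forall A : set (borel X), measurable A ->
      mu A = (\sum_(j < N) (a j)%:E * \d_(x j : borel X) A)%E.

Section uniform.
Context X (N : nat) (x : nat -> X).

(* (1 / (N + 1)) * \sum_(j < N + 1) \d_(x j) *)
Definition unif_measure : set (borel X) -> \bar R :=
  mscale (N.+1%:R^-1)%:nng (msum (fun j => \d_(x j : borel X)) N.+1).

HB.instance Definition _ := Measure.on unif_measure.

Let unif_setT : unif_measure setT = 1%E.
Proof.
rewrite /unif_measure /mscale /= /msum.
rewrite (eq_bigr (fun=> 1%E)) => [|j _]; last exact: diracT.
by rewrite sumEFin big_const iter_addr addr0 card_ord -EFinM mulVf//.
Qed.

HB.instance Definition _ :=
  Measure_isProbability.Build _ _ _ unif_measure unif_setT.

Definition unif_prob : probability (borel X) R := unif_measure.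

Lemma unif_radon : radon unif_prob.
Proof.
move=> A mA; apply/eqP; rewrite eq_le; apply/andP; split; last first.
  apply: ge_ereal_sup => _ [K [cK KA] <-]; apply: le_measure; rewrite ?inE//.
  rewrite -[X in measurable X]setCK; apply: measurableC.
  apply: sub_sigma_algebra; rewrite openC.
  by apply: compact_closed => //; exact: metric_hausdorff.
pose K := A `&` [set x j | j in `I_N.+1].
apply: ereal_sup_ubound; exists K.
  split; last by move=> y [].
  by apply: finite_compact; apply: finite_setIr; exact: finite_image.
rewrite /unif_prob /= /unif_measure /mscale /= /msum; congr (_ * _)%E.
apply: eq_bigr => j _; rewrite /= !diracE; congr (_%:R%:E).
congr (nat_of_bool _).
apply/idP/idP; rewrite !inE; first by case.
by move=> Aj; split=> //; exists (val j) => /=.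
Qed.

Lemma unif_moment (p : R) : finite_moment p unif_prob.
Proof.
exists (x 0).
have mf : measurable_fun setT
    (fun y : borel X => (mdist (x 0) (y : X) `^ p)%:E).
  apply/measurable_EFinP/(measurableT_comp (measurable_powR p)).
  exact: measurable_mdist.
have f0 y : setT y -> (0 <= (mdist (x 0) y `^ p)%:E)%E.
  by rewrite lee_fin powR_ge0.
rewrite ge0_integral_mscale// ge0_integral_measure_sum//.
rewrite (_ : (\sum_(_ < _) _)%E =
    (\sum_(j < N.+1) mdist (x 0) (x j) `^ p)%:E) ?ltry//.
rewrite -sumEFin; apply: eq_bigr => j _.
by rewrite integral_dirac// diracT mul1e.
Qed.

Definition unif (p : R) : Pp X p := MkPp unif_radon (unif_moment p).

End uniform.

Lemma Wp_unif0 X (p : R) (x : X) (mu := unif 0 (fun=> x) p) :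
  0 <= Wp mu mu <= (0 `^ p) `^ p^-1.
Proof.
rewrite /Wp; set S := (X in ereal_inf X).
have S0 : (0 <= ereal_inf S)%E.
  by apply: le_ereal_inf_tmp => _ [g _ <-]; exact: poweR_ge0.
have S1 : (ereal_inf S <= ((0 `^ p) `^ p^-1)%:E)%E.
  apply: ereal_inf_lbound; exists (\d_((x, x) : borel (X * X))).
    have muE (A : set (borel X)) : mu A = \d_(x : borel X) A.
      rewrite /mu /= /unif_measure /mscale /= /msum.
      by rewrite big_ord1/= invr1 mul1e.
    move=> A mA; rewrite !muE /= !diracE; split; congr (_%:R%:E).
      by congr nat_of_bool; apply/idP/idP; rewrite !inE => // -[].
    by congr nat_of_bool; apply/idP/idP; rewrite !inE => // -[].
  rewrite integral_dirac//=; last exact: measurable_mdist2.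
  by rewrite indicT mul1r mdistxx.
have Sfin : ereal_inf S \is a fin_num.
  by rewrite ge0_fin_numE//; apply: le_lt_trans S1 _; exact: ltry.
by rewrite fine_ge0//= -lee_fin fineK.
Qed.

End wasserstein.

Section wasserstein_ultralimit.
Context {R : realType} (omega : free_ultrafilter).
Context (X : nat -> pointedMetricType R) (p : R).

Let W i (mu nu : Pp (X i) p) : R := Wp mu nu.
(* unif 0 (fun=> x) is the Dirac mass at x. *)
Let delta_e i : Pp (X i) p := unif 0 (fun=> point) p.

Definition Pp_ultra := ultraproduct omega (fun i => Pp (X i) p).

Definition Pp_lim : Type := ulim omega W delta_e.

Definition Pp_hat : Type := @ultralimit R omega (fun i => Pp (X i) p) W delta_e.

Definition st_Wp (m : Pp_lim) : Pp_hat := ulim_st m.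

Definition Wp_hat (x y : Pp_hat) : R := ultralimit_dist x y.

HB.instance Definition _ := Choice.on Pp_hat.

Lemma delta_e_lim : in_lim W delta_e (uclass omega delta_e).
Proof.
apply/hfinite_class; exists ((0 `^ p) `^ p^-1).
have de := urepr_class omega delta_e.
apply: filterS de => i /= ->.
by have /andP[W0 W1] := Wp_unif0 p (point : X i); rewrite /W ger0_norm.
Qed.

Definition delta_e_hat : Pp_hat := st_Wp (exist _ _ delta_e_lim).

(* unif N only uses the first N + 1 terms of a sequence. *)
Definition is_iota (f : Pp (hat omega X) p -> Pp_hat) : Prop :=
  (forall mu nu, Wp_hat (f mu) (f nu) = Wp mu nu) /\
  (forall (N : nat) (x : nat -> forall i, X i) (xhat : nat -> uspace_lim omega X),
    (forall j, sval (xhat j) = uclass omega (x j)) ->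
    exists2 m : Pp_lim,
      sval m = uclass omega (fun i => unif N (fun j => x j i) p) &
      f (unif N (fun j => st_hat (xhat j)) p) = st_Wp m).

(* is_iota determines f, since the measures unif N y p are dense in
   Pp (hat omega X) p; the default value of xget is irrelevant. *)
Definition iota : Pp (hat omega X) p -> Pp_hat :=
  xget (fun=> delta_e_hat) is_iota.

Definition lifting (mu : Pp (hat omega X) p) (muw : Pp_lim) : Prop :=
  st_Wp muw = iota mu.

Definition hyperfinite (muw : Pp_ultra) : Prop :=
  exists2 m : forall i, Pp (X i) p,
    muw = uclass omega m & forall i, discrete_measure (m i).

End wasserstein_ultralimit.

Section loeb.
Context {R : realType} (omega : free_ultrafilter).
Context (X : nat -> pointedMetricType R).

Definition internal (B : forall i, set (X i)) : set (uspace omega X) :=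
  [set uclass omega x | x in [set x | ultra_sets omega [set i | B i (x i)]]].

Definition internal_borel : set (set (uspace omega X)) :=
  [set C | exists2 B : forall i, set (X i),
    (forall i, measurable (B i : set (borel (X i)))) & C = internal B].

Lemma internal_urepr B x :
  internal B x <-> ultra_sets omega [set i | B i (urepr x i)].
Proof.
split=> [[y By <-]|Bx]; last by exists (urepr x) => //; exact: ureprK.
by apply: filterS (filterI By (urepr_class omega y)) => i /= [? ->].
Qed.

Lemma internalC B : ~` internal B = internal (fun i => ~` B i).
Proof.
apply/seteqP; split => x.
  move=> /= nBx; apply/internal_urepr.
  have [/internal_urepr//|] := in_ultra_setVsetC
    [set i | B i (urepr x i)] (ultra_setsP omega).
  exact.
move=> /internal_urepr nBx /internal_urepr Bx.
apply: (@filter_not_empty _ (ultra_sets omega)).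
by apply: filterS (filterI nBx Bx) => i /= [].
Qed.

Lemma internalU B C : internal B `|` internal C = internal (fun i => B i `|` C i).
Proof.
apply/seteqP; split => x.
  by move=> [] /internal_urepr Bx; apply/internal_urepr;
    apply: filterS Bx => i /= ?; [left|right].
move=> /internal_urepr BCx.
have [Bx|nBx] := in_ultra_setVsetC
  [set i | B i (urepr x i)] (ultra_setsP omega).
  by left; apply/internal_urepr.
by right; apply/internal_urepr; apply: filterS (filterI BCx nBx) => i /= [[]].
Qed.

Lemma internal0 : internal (fun=> set0) = set0.
Proof.
by apply/seteqP; split => x // /internal_urepr; exact: filter_not_empty.
Qed.

Lemma internal_sub B C : internal B `<=` internal C ->
  ultra_sets omega [set i | B i `<=` C i].
Proof.
move=> BC; have [//|nBC] := in_ultra_setVsetC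
  [set i | B i `<=` C i] (ultra_setsP omega).
pose x i : X i := xget point (B i `\` C i).
have xBC : ultra_sets omega [set i | (B i `\` C i) (x i)].
  apply: filterS nBC => i /= /existsNP[y /not_implyP[By Cy]].
  by apply: (@xgetPex _ _ (B i `\` C i)); exists y.
have /BC/internal_urepr Cx : internal B (uclass omega x).
  by exists x => //; apply: filterS xBC => i [].
exfalso; apply: (@filter_not_empty _ (ultra_sets omega)).
apply: filterS (filterI (filterI xBC Cx) (urepr_class omega x)) => i /=.
by move=> [[[_ nC] +] xE]; rewrite xE.
Qed.

HB.instance Definition _ := Choice.on (uspace omega X).
HB.instance Definition _ :=
  isPointed.Build (uspace omega X) (uclass omega (fun i => point : X i)).

Let internal_borel0 : internal_borel set0.
Proof. by exists (fun=> set0); rewrite ?internal0. Qed.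

Let internal_borelU : setU_closed internal_borel.
Proof.
move=> _ _ [B mB ->] [C mC ->]; exists (fun i => B i `|` C i).
  by move=> i; exact: measurableU.
exact: internalU.
Qed.

Let internal_borelC : setC_closed internal_borel.
Proof.
move=> _ [B mB ->]; exists (fun i => ~` B i); last exact: internalC.
by move=> i; exact: measurableC.
Qed.

HB.instance Definition _ := isAlgebraOfSets.Build default_measure_display
  (uspace omega X) internal_borel0 internal_borelU internal_borelC.

Section loeb_measure.
Context (mu : forall i, probability (borel (X i)) R).

(* The value [(mu_i (B_i))] does not depend on the choice of B such that
   C = internal B; sets which are not internal get the dummy value 0. *)
Definition internal_measure (C : set (uspace omega X)) :
    hyperreal (R := R) omega :=
  xget (hstd omega 0) [set a | exists2 B : forall i, set (X i),
    (forall i, measurable (B i : set (borel (X i)))) &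
    C = internal B /\ a = uclass omega (fun i => fine (mu i (B i)))].

Lemma internal_measureE (B : forall i, set (X i)) :
  (forall i, measurable (B i : set (borel (X i)))) ->
  internal_measure (internal B) = uclass omega (fun i => fine (mu i (B i))).
Proof.
move=> mB; apply: xget_unique => [|a [C mC [BC ->]]]; first by exists B.
have CB : internal C `<=` internal B by rewrite BC.
have {}BC : internal B `<=` internal C by rewrite BC.
apply/uclassP; apply: filterS (filterI (internal_sub BC) (internal_sub CB)).
by move=> i [BCi CBi] /=; congr (fine (mu i _)); exact/seteqP.
Qed.

Definition loeb_premeasure (C : set (uspace omega X)) : \bar R :=
  (hst (internal_measure C))%:E.

Let mu_cvg (B : forall i, set (X i)) :
  (forall i, measurable (B i : set (borel (X i)))) ->
  fine (mu i (B i)) @[i --> ultra_sets omega] -->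
  hst (internal_measure (internal B)).
Proof.
move=> mB; rewrite internal_measureE//; apply: hst_class_cvg.
apply/hfinite_class; exists 1; apply: filterS filterT => i _ /=.
have muB : mu i (B i) \is a fin_num by exact: fin_num_measure.
rewrite ger0_norm; last by rewrite fine_ge0.
by rewrite -lee_fin (fineK muB); exact: probability_le1.
Qed.

Let loeb_premeasure_ge0 C : (0 <= loeb_premeasure C)%E.
Proof.
rewrite lee_fin.
have [[B mB ->]|nC] := pselect (internal_borel C).
  apply: (ultra_le_cvg (cvg_cst _) (mu_cvg mB)).
  by apply: filterS filterT => i _ /=; rewrite fine_ge0.
rewrite /internal_measure; case: xgetP => [a _ [B mB [CB _]]|_].
  by case: nC; exists B.
by rewrite (hst_cvg (cvg_cst 0)).
Qed.

Let loeb_premeasure_additive : measure_function.semi_additive loeb_premeasure.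
Proof.
have l0 : loeb_premeasure set0 = 0%E.
  rewrite /loeb_premeasure -internal0 internal_measureE; last first.
    by move=> i; exact: measurable0.
  congr (_%:E); apply: hst_cvg; rewrite (_ : (fun _ => _) = fun=> 0).
    exact: cvg_cst.
  by apply/funext => i; rewrite measure0.
apply/(additive2P l0) => _ _ [B mB ->] [C mC ->] BC0.
rewrite /loeb_premeasure internalU -EFinD; congr (_%:E).
have mBC i : measurable (B i `|` C i : set (borel (X i))).
  exact: measurableU.
rewrite internal_measureE//.
have -> : uclass omega (fun i => fine (mu i (B i `|` C i))) =
    uclass omega (fun i => fine (mu i (B i)) + fine (mu i (C i))).
  apply/uclassP; have /internal_sub : internal B `<=` internal (fun i => ~` C i).
    by rewrite -internalC; apply/disjoints_subset.
  apply: filterS => i /disjoints_subset BCi /=.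
  have finB := fin_num_measure (mu i) _ (mB i).
  have finC := fin_num_measure (mu i) _ (mC i).
  have := fineD finB finC; rewrite -measureU//.
by apply: hst_cvg; apply: cvgD; exact: mu_cvg.
Qed.

HB.instance Definition _ := isContent.Build _ _ _ loeb_premeasure
  loeb_premeasure_ge0 loeb_premeasure_additive.

(* Restricted to the sigma-algebra (loeb mu).-cara.-measurable, on which it is a
   complete measure, this is the Loeb measure. *)
Definition loeb : {outer_measure set (uspace omega X) -> \bar R} :=
  (loeb_premeasure^*)%mu.

End loeb_measure.

(* mu_i is determined by muw for almost all i only, which is enough for loeb. *)
Definition Loeb (p : R) (muw : Pp_ultra omega X p) :
    {outer_measure set (uspace omega X) -> \bar R} :=
  loeb (fun i => urepr muw i).

(* Sets of outer measure zero are Caratheodory measurable. *)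
Definition concentrated_on_lim (muL : set (uspace omega X) -> \bar R) : Prop :=
  muL (~` range (sval : uspace_lim omega X -> uspace omega X)) = 0%E.

Definition st_hat_preimage (B : set (hat omega X)) : set (uspace omega X) :=
  [set sval x | x in st_hat (omega := omega) (X := X) @^-1` B].

Definition st_hat_pushforward (muL : {outer_measure set (uspace omega X) -> \bar R})
    (mu : set (borel (hat omega X)) -> \bar R) : Prop :=
  forall B : set (borel (hat omega X)), measurable B ->
    muL.-cara.-measurable (st_hat_preimage B) /\ muL (st_hat_preimage B) = mu B.

End loeb.

(* Main.v *)
Require Import Defs.
From HB Require Import structures.
From mathcomp Require Import all_boot all_order all_algebra.
From mathcomp Require Import all_classical all_reals all_analysis.
From mathcomp Require Import measurable_realfun.
From mathcomp Require Import lra ring.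

Set Implicit Arguments.
Unset Strict Implicit.
Unset Printing Implicit Defensive.

Import Order.TTheory GRing.Theory Num.Theory.
Import numFieldNormedType.Exports.
Local Open Scope classical_set_scope.
Local Open Scope ring_scope.

(** Let [mu] be a Radon probability measure with finite moment on the ultralimit.
    The theorem asks for internal discrete measures that represent [iota mu], and
    for the identification of the image of their Loeb measure with [mu].

    The lifting.  Uniform measures on finitely many points are dense
    ([unif_dense]), and the distance between two of them depends on the mutual
    distances of their points only, in a Lipschitz way ([Wp_unif_le]).  Distances
    in the ultralimit are limits of distances between representatives, so the
    Wasserstein distance between two uniform measures on the ultralimit is the
    limit of the distances between the internal uniform measures on
    representatives of their points ([unif_near]).  A sequence of uniform measures
    that converges to [mu] thus yields a Cauchy sequence of internal uniform
    measures, and saturation provides an internal uniform measure to which it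
    converges ([cauchy_diagonal], [approximates_exists]).  The same approximations
    show that [iota] exists and that it maps [mu] to the class of this measure
    ([is_iota_exists], [is_iota_unique]).

    These arguments need the triangle inequality for arbitrary Radon measures on
    an arbitrary metric space, since an element of the ultralimit may be
    represented by measures that are not discrete.  Its usual proof disintegrates
    two couplings over their common marginal.  It is enough here to cut that
    marginal into finitely many small pieces and to multiply the slices of the two
    couplings over each piece ([quantization], [cost_le_glue]).  The products have
    to be defined on the Borel sets of a product of possibly nonseparable spaces;
    they are, because a Radon measure is concentrated on a separable set, onto
    which the space can be retracted ([measurable_retract_pair]).

    The image measure.  If two measures are close for the Wasserstein distance,
    then a small enlargement of a set has, for the second measure, almost the mass
    that the set has for the first ([Wp_enlargement]).  For a compact [K], the
    internal measure of the neighbourhoods of finite nets of [K] is therefore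
    almost [mu K], and a diagonal choice gives an internal set inside the preimage
    of [K] whose Loeb measure is at least [mu K] ([loeb_compact]).  Since [mu] is
    Radon, the preimage of a Borel set and that of its complement contain disjoint
    internal sets whose Loeb measures add up to almost [1].  So the preimage is
    measurable, of measure [mu B] ([Loeb_pushforward]), and for the whole space
    one gets that almost every point is at finite distance from the base point
    ([Loeb_concentrated]).  That the Loeb outer measure of an internal set is the
    standard part of its internal measure follows from saturation once more
    ([internal_compact]). *)

(** * A convexity inequality in place of Minkowski's *)

Section powR_split.
Context {R : realType} (p : R).
Hypothesis p1 : 1 <= p.

(** Convexity of the power [p] at the barycentre of [(a + b) / a * u] and
    [(a + b) / b * v].  Integrated, it gives Minkowski's inequality in the form
    in which it is used below: if [u] and [v] have [p]-norms at most [a] and [b],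
    then [powR_splitE] evaluates the resulting bound to [(a + b) `^ p].  Being
    linear in [u `^ p] and [v `^ p], it can be summed over the pieces of a
    partition, each of which carries its own product measure. *)
Lemma powR_split (a b u v : R) : 0 < a -> 0 < b -> 0 <= u -> 0 <= v ->
  (u + v) `^ p <= ((a + b) / a) `^ (p - 1) * u `^ p +
                  ((a + b) / b) `^ (p - 1) * v `^ p.
Proof.
move=> a0 b0 u0 v0; have ab0 : 0 < a + b by rewrite addr_gt0.
have p0 : 0 < p by rewrite (lt_le_trans _ p1).
have t0 : 0 <= a / (a + b) by rewrite divr_ge0// ltW.
have t1 : a / (a + b) <= 1 by rewrite ler_pdivrMr// mul1r lerDl ltW.
have E : b / (a + b) = 1 - a / (a + b).
  by field; rewrite gt_eqF.
have scale c w : 0 < c -> 0 <= w ->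
    ((a + b) / c) `^ (p - 1) * w `^ p = c / (a + b) * ((a + b) / c * w) `^ p.
  move=> c0 w0; have q0 : 0 < (a + b) / c by rewrite divr_gt0.
  rewrite (powRM p (ltW q0) w0).
  rewrite -(mulr_powRB1 (ltW q0) p0); field.
  by rewrite !gt_eqF.
rewrite !scale// E.
have cvx x y : 0 <= x -> 0 <= y ->
    (a / (a + b) * x + (1 - a / (a + b)) * y) `^ p <=
    a / (a + b) * x `^ p + (1 - a / (a + b)) * y `^ p.
  by move=> x0 y0; apply: (convex_powR p1 (Itv01 t0 t1));
    rewrite inE/= in_itv/= andbT.
apply: le_trans (cvx _ _ _ _).
- rewrite -E le_eqVlt; apply/orP; left; apply/eqP; congr (_ `^ _).
  by field; rewrite !gt_eqF.
- by rewrite mulr_ge0// divr_ge0// ltW.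
- by rewrite mulr_ge0// divr_ge0// ltW.
Qed.

Lemma powR_splitE (a b : R) : 0 < a -> 0 < b ->
  ((a + b) / a) `^ (p - 1) * a `^ p + ((a + b) / b) `^ (p - 1) * b `^ p =
  (a + b) `^ p.
Proof.
move=> a0 b0; have ab0 : 0 < a + b by rewrite addr_gt0.
have p0 : 0 < p by rewrite (lt_le_trans _ p1).
have E c : 0 < c -> ((a + b) / c) `^ (p - 1) * c `^ p = (a + b) `^ (p - 1) * c.
  move=> c0; rewrite -(mulr_powRB1 (ltW c0) p0) mulrCA mulrA [c * _]mulrC.
  rewrite -mulrA mulrCA -powRM ?divr_ge0 ?(ltW c0) ?(ltW ab0)//.
  by rewrite divfK ?gt_eqF// mulrC.
by rewrite !E// -mulrDr mulrC mulr_powRB1// ltW.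
Qed.

End powR_split.

(** * Mixtures of image measures *)

Section mixture.
Context d1 d2 (T : measurableType d1) (Y : measurableType d2) {R : realType}.
Variables (m : nat -> {measure set T -> \bar R}) (phi : nat -> T -> Y).
Hypothesis mphi : forall j, measurable_fun setT (phi j).

Definition image_measure of (forall j, measurable_fun setT (phi j)) :=
  fun j : nat => pushforward (m j) (phi j) : set Y -> \bar R.

Let image_measureT j : measure Y R :=
  @measure_function_pushforward__canonical__measure_function_Measure
    _ _ T Y R (m j) (phi j) (mphi j).

HB.instance Definition _ j := isMeasure.Build _ _ _ (image_measure mphi j)
  (@measure0 _ _ _ (image_measureT j)) (@measure_ge0 _ _ _ (image_measureT j))
  (@measure_semi_sigma_additive _ _ _ (image_measureT j)).

(** All couplings constructed below are of this form: finitely many measures on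
    an auxiliary space, each pushed forward by a map into the product. *)
Definition mixture (n : nat) : set Y -> \bar R := msum (image_measure mphi) n.

HB.instance Definition _ n := Measure.on (mixture n).

Lemma mixtureE n A : mixture n A = (\sum_(j < n) m j (phi j @^-1` A))%E.
Proof. by []. Qed.

Lemma ge0_integral_mixture n (f : Y -> \bar R) : measurable_fun setT f ->
  (forall y, 0 <= f y)%E ->
  (\int[mixture n]_y f y = \sum_(j < n) \int[m j]_t f (phi j t))%E.
Proof.
move=> mf f0; rewrite ge0_integral_measure_sum//.
by apply: eq_bigr => j _; rewrite ge0_integral_pushforward.
Qed.

End mixture.

(** * Couplings and their cost *)

(** This makes the Borel sets of a product an instance of the Borel sets of a
    pointed topological space. *)
HB.instance Definition _ (X Y : ptopologicalType) := Topological.on (X * Y)%type.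

Lemma continuous_borel_measurable (T U : ptopologicalType) (f : T -> U) :
  continuous f -> measurable_fun setT (f : borel T -> borel U).
Proof.
move=> cf; apply: (@measurability _ _ (borel T) (borel U) setT f (open : set (set U)) erefl) => _ [B oB <-].
by rewrite setTI; apply: sub_sigma_algebra; exact: open_comp.
Qed.

Section transport.
Context {R : realType}.
Implicit Type X : pointedMetricType R.

Definition transport_cost X (p : R) (gamma : set (borel (X * X)) -> \bar R) :=
  (\int[gamma]_z (mdist (z : X * X).1 z.2 `^ p)%:E)%E.

(** The couplings are kept rather than the infimum of their costs: the infimum
    need not be attained, and [Wp] is zero when there is no coupling of finite
    cost. *)
Definition cost_le X (p : R) (mu nu : probability (borel X) R) (C : R) :=
  exists2 gamma : probability (borel (X * X)) R,
    coupling mu nu gamma & (transport_cost p gamma <= C%:E)%E.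

Lemma cost_le_trans X p (mu nu : probability (borel X) R) C D :
  C <= D -> cost_le p mu nu C -> cost_le p mu nu D.
Proof.
move=> CD [g cg gC]; exists g => //; apply: le_trans gC _.
by rewrite lee_fin.
Qed.

Lemma measurable_fst_borel X : measurable_fun setT (fst : borel (X * X) -> borel X).
Proof. by apply: (@continuous_borel_measurable (X * X)%type X) => z; exact: cvg_fst. Qed.

Lemma measurable_snd_borel X : measurable_fun setT (snd : borel (X * X) -> borel X).
Proof. by apply: (@continuous_borel_measurable (X * X)%type X) => z; exact: cvg_snd. Qed.

Lemma measurable_pair_borel X (y : X) :
  measurable_fun setT ((fun x => (x, y)) : borel X -> borel (X * X)).
Proof.
by apply: (@continuous_borel_measurable X (X * X)%type) => x;
  apply: cvg_pair => //=; exact: cvg_cst.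
Qed.

Lemma measurable_diag_borel X :
  measurable_fun setT ((fun x => (x, x)) : borel X -> borel (X * X)).
Proof.
by apply: (@continuous_borel_measurable X (X * X)%type) => x; apply: cvg_pair.
Qed.

Lemma measurable_swap_borel X :
  measurable_fun setT ((fun z => (z.2, z.1)) : borel (X * X) -> borel (X * X)).
Proof.
by apply: (@continuous_borel_measurable (X * X)%type (X * X)%type) => z;
  apply: cvg_pair; [exact: cvg_snd|exact: cvg_fst].
Qed.

Lemma cost_le_mixture X p (mu nu : probability (borel X) R) d
    (T : measurableType d) n (m : nat -> {measure set T -> \bar R})
    (phi : nat -> T -> borel (X * X)) C :
  (forall j, measurable_fun setT (phi j)) ->
  (forall A : set (borel X), measurable A ->
    \sum_(j < n) m j ((fst \o phi j) @^-1` A) = mu A)%E ->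
  (forall A : set (borel X), measurable A ->
    \sum_(j < n) m j ((snd \o phi j) @^-1` A) = nu A)%E ->
  (\sum_(j < n) \int[m j]_t (mdist (phi j t).1 (phi j t).2 `^ p)%:E <= C%:E)%E ->
  cost_le p mu nu C.
Proof.
move=> mphi mmu mnu mC.
have muE A : mixture m mphi n (A `*` setT) =
    (\sum_(j < n) m j ((fst \o phi j) @^-1` A))%E.
  rewrite mixtureE; apply: eq_bigr => j _; congr (m j _).
  by apply/seteqP; split => z //= [].
have nuE A : mixture m mphi n (setT `*` A) =
    (\sum_(j < n) m j ((snd \o phi j) @^-1` A))%E.
  rewrite mixtureE; apply: eq_bigr => j _; congr (m j _).
  by apply/seteqP; split => z //= [].
have m1 : mixture m mphi n setT = 1%E.
  by rewrite -setXTT muE mmu// probability_setT.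
pose g : probability (borel (X * X)) R :=
  HB.pack (mixture m mphi n) (Measure_isProbability.Build _ _ _ _ m1).
exists g.
  by move=> A mA; rewrite -mmu// -mnu// -muE -nuE.
rewrite /transport_cost ge0_integral_mixture//.
  exact: measurable_mdist2.
by move=> z; rewrite lee_fin powR_ge0.
Qed.

Lemma coupling_setT1 X (mu nu : probability (borel X) R) g (A : set (borel X)) :
  coupling mu nu g -> measurable A -> g ((fst : X * X -> X) @^-1` A) = mu A.
Proof.
by move=> cg mA; rewrite -(cg _ mA).1; congr (g _); apply/seteqP; split => z //= [].
Qed.

Lemma coupling_setT2 X (mu nu : probability (borel X) R) g (A : set (borel X)) :
  coupling mu nu g -> measurable A -> g ((snd : X * X -> X) @^-1` A) = nu A.
Proof.
by move=> cg mA; rewrite -(cg _ mA).2; congr (g _); apply/seteqP; split => z //= [].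
Qed.

Lemma cost_le_sym X p (mu nu : probability (borel X) R) C :
  cost_le p mu nu C -> cost_le p nu mu C.
Proof.
move=> [g cg gC].
apply: (@cost_le_mixture _ _ _ _ _ (borel (X * X)) 1 (fun=> g) (fun=> fun z => (z.2, z.1))).
- by move=> _; exact: measurable_swap_borel.
- by move=> A mA; rewrite big_ord1 -(coupling_setT2 cg mA).
- by move=> A mA; rewrite big_ord1 -(coupling_setT1 cg mA).
rewrite big_ord1; apply: le_trans gC.
by under eq_integral do rewrite metric_sym.
Qed.

Lemma cost_le_refl X p (mu : probability (borel X) R) : 0 < p ->
  cost_le p mu mu 0.
Proof.
move=> p0.
apply: (@cost_le_mixture _ _ _ _ _ (borel X) 1 (fun=> mu) (fun=> fun x => (x, x))).
- by move=> _; exact: measurable_diag_borel.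
- by move=> A mA; rewrite big_ord1.
- by move=> A mA; rewrite big_ord1.
rewrite big_ord1 integral0_eq// => x _.
by rewrite /= mdistxx powR0// gt_eqF.
Qed.

End transport.

Section Wp_cost.
Context {R : realType} (X : pointedMetricType R) (p : R).
Hypothesis p0 : 0 < p.
Implicit Types mu nu : Pp X p.

Let S mu nu : set (\bar R) := [set (\int[gamma]_z (mdist (z : X * X).1 z.2 `^ p)%:E) `^ p^-1
      | gamma in coupling mu nu]%E.

Let S0 mu nu : (0 <= ereal_inf (S mu nu))%E.
Proof. by apply: le_ereal_inf_tmp => _ [g _ <-]; exact: poweR_ge0. Qed.

Lemma Wp_ge0 mu nu : 0 <= Wp mu nu.
Proof. by apply: fine_ge0; exact: (S0 mu nu). Qed.

Let rootp c : 0 <= c -> (c `^ p) `^ p^-1 = c.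
Proof. by move=> c0; rewrite -powRrM mulfV ?gt_eqF// powRr1. Qed.

Let Sub mu nu c : 0 <= c -> cost_le p mu nu (c `^ p) ->
  (ereal_inf (S mu nu) <= c%:E)%E.
Proof.
move=> c0 [g cg gC]; apply: ge_ereal_inf; exists (transport_cost p g `^ p^-1)%E.
  by exists g.
rewrite -[in leRHS](rootp c0) -poweR_EFin.
apply: gt0_ler_poweR => //.
- by rewrite invr_ge0 ltW.
- rewrite in_itv/= leey andbT; apply: integral_ge0 => z _.
  by rewrite lee_fin powR_ge0.
- by rewrite in_itv/= leey andbT lee_fin powR_ge0.
Qed.

Lemma Wp_le mu nu c : 0 <= c -> cost_le p mu nu (c `^ p) -> Wp mu nu <= c.
Proof.
move=> c0 /(Sub c0) Sc; rewrite /Wp -/(S mu nu) -lee_fin fineK//.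
by rewrite ge0_fin_numE//; apply: le_lt_trans Sc _; exact: ltry.
Qed.

(** A coupling of finite cost has to be known beforehand: without one, the
    infimum is infinite and [Wp mu nu] is the default value [0]. *)
Lemma Wp_lt mu nu C c : cost_le p mu nu C -> Wp mu nu < c ->
  cost_le p mu nu (c `^ p).
Proof.
move=> muC Wc; have C0 : 0 <= C.
  case: muC => g _; rewrite -lee_fin; apply: le_trans.
  by apply: integral_ge0 => z _; rewrite lee_fin powR_ge0.
have c0 : 0 <= c by apply: le_trans (Wp_ge0 mu nu) (ltW Wc).
have Sfin : ereal_inf (S mu nu) \is a fin_num.
  rewrite ge0_fin_numE//.
  have C1 : 0 <= C `^ p^-1 by exact: powR_ge0.
  have : cost_le p mu nu ((C `^ p^-1) `^ p).
    by rewrite -powRrM mulVf ?gt_eqF// powRr1.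
  by move=> /(Sub C1) SC; apply: le_lt_trans SC _; exact: ltry.
have : (ereal_inf (S mu nu) < c%:E)%E.
  by rewrite -(fineK Sfin) lte_fin.
move=> /ereal_inf_lt[_ [g cg <-]] gc; exists g => //.
have g0 : (0 <= transport_cost p g)%E.
  by apply: integral_ge0 => z _; rewrite lee_fin powR_ge0.
rewrite leNgt; apply/negP => cg'; move: gc; apply/negP; rewrite -leNgt.
rewrite -[leLHS](congr1 EFin (rootp c0)) -poweR_EFin.
apply: gt0_ler_poweR => //.
- by rewrite invr_ge0 ltW.
- by rewrite in_itv/= leey andbT lee_fin powR_ge0.
- by rewrite in_itv/= leey andbT.
- exact: ltW.
Qed.

End Wp_cost.

(** * Separable supports of Radon measures *)

Lemma inv_nat_lt {R : realType} (e : R) : 0 < e -> exists n : nat, n.+1%:R^-1 < e.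
Proof.
move=> e0; have [N _ /(_ N (leqnn N)) Ne] := near_infty_natSinv_lt (PosNum e0).
by exists N.
Qed.

(** Stated for variables so that it applies to distances up to conversion
    between the number structures of [R]. *)
Lemma half_lt {R : realType} (a b c q e : R) :
  q < e / 2 -> c <= a + b -> a < q -> b < q -> c < e.
Proof. lra. Qed.

Section metric_balls.
Context {R : realType} {X : pointedMetricType R}.

Lemma mdist_triangle (x y z : X) : mdist x z <= mdist x y + mdist y z.
Proof. exact: metric_triangle. Qed.

Lemma mdistC (x y : X) : mdist x y = mdist y x.
Proof. exact: metric_sym. Qed.

Definition mball (x : X) (e : R) : set X := [set y | mdist x y < e].

Lemma mball_ball x e : mball x e = ball x e.
Proof. by rewrite ballEmdist. Qed.

Lemma mballxx x e : 0 < e -> mball x e x.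
Proof. by move=> e0; rewrite /mball/= mdistxx. Qed.

Lemma open_mball x e : open (mball x e).
Proof.
rewrite openE => y xy; have e0 : 0 < e - mdist x y by rewrite subr_gt0.
apply: filterS (nbhsx_ballx y _ e0) => z; rewrite -mball_ball /mball/=.
by rewrite ltrBrDl; apply: le_lt_trans; exact: mdist_triangle.
Qed.

Lemma open_borel (U : set X) : open U -> measurable (U : set (borel X)).
Proof. exact: sub_sigma_algebra. Qed.

Lemma measurable_mball x e : measurable (mball x e : set (borel X)).
Proof. by apply: open_borel; exact: open_mball. Qed.

Lemma compact_borel (K : set X) : compact K -> measurable (K : set (borel X)).
Proof.
move=> cK; rewrite -[X in measurable X]setCK; apply: measurableC.
apply: open_borel; rewrite openC; apply: compact_closed => //.
exact: metric_hausdorff.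
Qed.

(** The balls centred on [K] form an open cover of it. *)
Lemma compact_net (K : set X) e : compact K -> 0 < e ->
  exists s : seq X, (forall x, x \in s -> K x) /\
    forall y, K y -> exists2 x, x \in s & mball x e y.
Proof.
rewrite compact_cover => /(_ X K (mball^~ e)) cK e0.
have [|y Ky|D DK KD] := cK; first by move=> x _; exact: open_mball.
  by exists y => //; exact: mballxx.
exists (finmap.enum_fset D); split=> [x xD|y /KD[x xD xy]]; last by exists x.
by have := DK x xD; rewrite in_setE.
Qed.

End metric_balls.

Section dense_sequence.
Context {R : realType} {X : pointedMetricType R}.
Implicit Type mu : probability (borel X) R.

(** This is the closure of the range of [D], in a form that makes it visibly
    Borel. *)
Definition approx_by (D : nat -> X) : set X :=
  \bigcap_n \bigcup_k mball (D k) n.+1%:R^-1.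

Lemma measurable_approx_by D : measurable (approx_by D : set (borel X)).
Proof.
apply: bigcap_measurable => // n _; apply: bigcup_measurable => k _.
exact: measurable_mball.
Qed.

Lemma radon_compact mu (A : set (borel X)) (e : R) : radon mu -> measurable A ->
  0 < e -> exists K : set X, [/\ compact K, K `<=` A & (mu A <= mu K + e%:E)%E].
Proof.
move=> rmu mA e0; have fA : mu A \is a fin_num by exact: fin_num_measure.
have := rmu A mA => muA; have : (mu A - e%:E < mu A)%E.
  by rewrite lteBlDr// lteDl// lte_fin.
rewrite [in X in (_ < X)%E]muA => /ereal_sup_gt[_ [K [cK KA] <-]] muK.
by exists K; split => //; rewrite -leeBlDr// ltW.
Qed.

(** Take for [D] all points of finite [1 / (n + 1)]-nets of compact sets whose
    measures tend to [1]. *)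
Lemma radon_separable mu : radon mu -> exists D : nat -> X, mu (approx_by D) = 1%E.
Proof.
move=> rmu.
have /choice[K KP] : forall m : nat, exists K : set X,
    compact K /\ (1 <= mu K + m.+1%:R^-1%:E)%E.
  move=> m; have m0 : 0 < m.+1%:R^-1 :> R by rewrite invr_gt0.
  have [K [cK _ muK]] := radon_compact rmu measurableT m0.
  by exists K; split => //; rewrite -(@probability_setT _ _ _ mu).
have /choice[s sP] : forall mn : nat * nat, exists s : seq X,
    forall y, K mn.1 y -> exists2 x, x \in s & mball x mn.2.+1%:R^-1 y.
  move=> [m n]; have n0 : 0 < n.+1%:R^-1 :> R by rewrite invr_gt0.
  by have [s [_ sP]] := compact_net (KP m).1 n0; exists s.
pose D k : X := if unpickle k is Some (mn, j) then nth point (s mn) j else point.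
exists D; have KD m : K m `<=` approx_by D.
  move=> y Ky n _; have [x xs xy] := sP (m, n) y Ky.
  exists (pickle ((m, n), index x (s (m, n)))) => //.
  by rewrite /D pickleK nth_index.
have mD : measurable (approx_by D : set (borel X)) by exact: measurable_approx_by.
apply/eqP; rewrite eq_le probability_le1//=.
apply/lee_addgt0Pr => e e0; have [m me] := inv_nat_lt e0.
apply: le_trans (KP m).2 _; apply: leeD; last by rewrite lee_fin ltW.
apply: le_measure; rewrite ?inE; [|exact: measurable_approx_by|].
  by apply: compact_borel; exact: (KP m).1.
exact: KD.
Qed.

(** Being constant outside of a separable set of full measure, this map has a
    separable range, and it is almost surely the identity. *)
Definition retract (D : nat -> X) (x : X) : X := if pselect (approx_by D x) then x else D 0%N.

Lemma approx_by0 D : approx_by D (D 0%N).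
Proof. by move=> n _; exists 0%N => //; apply: mballxx; rewrite invr_gt0. Qed.

Lemma retract_in D x : approx_by D (retract D x).
Proof. by rewrite /retract; case: pselect => // ?; exact: approx_by0. Qed.

Lemma retract_id D x : approx_by D x -> retract D x = x.
Proof. by rewrite /retract; case: pselect. Qed.

Lemma measurable_retract D : measurable_fun setT (retract D : borel X -> borel X).
Proof.
move=> _ A mA; rewrite setTI.
have -> : retract D @^-1` A = (approx_by D `&` A) `|`
    (if pselect (A (D 0%N)) then ~` approx_by D else set0).
  apply/seteqP; split => x; rewrite /retract/=.
    case: pselect => [Dx Ax|Dx AD]; first by left.
    by right; case: pselect.
  case=> [[Dx Ax]|]; first by case: pselect.
  by case: pselect => //= AD Dx; case: pselect.
apply: measurableU; first by apply: measurableI => //; exact: measurable_approx_by.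
by case: pselect => ?; [exact: (measurableC (measurable_approx_by D))|exact: measurable0].
Qed.

(** The Borel sigma-algebra of a product may be larger than the product of the
    Borel sigma-algebras, so that a product of two measures is in general not
    defined on it.  After retracting the factors on separable sets, the preimage
    of an open set is a countable union of rectangles, indexed by pairs of points
    of the dense sequences and by radii [1 / (n + 1)]; hence the image of a product
    measure by this map is defined on all Borel sets of the product. *)
Lemma measurable_retract_pair D D' :
  measurable_fun setT ((fun z => (retract D z.1, retract D' z.2)) :
    (borel X * borel X)%type -> borel (X * X)).
Proof.
apply: (@measurability _ _ _ (borel (X * X)) setT _ (open : set (set (X * X))) erefl).
move=> _ [U oU <-]; rewrite setTI.
pose F (i : nat * nat * nat) : set (borel X * borel X) :=
  if pselect (mball (D i.1.1) i.2.+1%:R^-1 `*` mball (D' i.1.2) i.2.+1%:R^-1 `<=` U)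
  then (retract D @^-1` mball (D i.1.1) i.2.+1%:R^-1) `*`
       (retract D' @^-1` mball (D' i.1.2) i.2.+1%:R^-1)
  else set0.
have -> : (fun z : borel X * borel X => (retract D z.1, retract D' z.2) : X * X) @^-1` U =
    \bigcup_i F i.
  apply/seteqP; split => [[x y]/= Uxy|[x y] [i _]]; last first.
    by rewrite /F; case: pselect => //= iU [ix iy]; exact: iU.
  move: oU; rewrite openE => /(_ _ Uxy); rewrite /interior => /nbhs_ballP[e /= e0 eU].
  have [n ne] : exists n : nat, n.+1%:R^-1 < e / 2.
    by apply: inv_nat_lt; rewrite divr_gt0.
  have [k _ kx] := @retract_in D x n I; have [l _ ly] := @retract_in D' y n I.
  exists ((k, l), n) => //; rewrite /F /=; case: pselect => //= -[]; case=> a b/= [ka lb].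
  apply: eU; split; rewrite /= -mball_ball /mball/=.
    apply: (half_lt ne (mdist_triangle _ (D k) _)) => //.
    by rewrite mdistC.
  apply: (half_lt ne (mdist_triangle _ (D' l) _)) => //.
  by rewrite mdistC.
apply: (countable_bigcupT_measurable (countableP _)).
have mr (E : nat -> X) y e : measurable (retract E @^-1` mball y e : set (borel X)).
  by rewrite -[X in measurable X]setTI; apply: measurable_retract => //;
    exact: measurable_mball.
move=> i; rewrite /F; case: pselect => ?; last exact: measurable0.
exact: (measurableX (mr D _ _) (mr D' _ _)).
Qed.

End dense_sequence.

(** * Quantization of a Radon measure *)

Section finite_partition.
Context {d} {T : measurableType d} {R : realType}.

Definition finite_partition (n : nat) (A : nat -> set T) : Prop :=
  [/\ forall j, measurable (A j), trivIset setT A &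
      \big[setU/set0]_(j < n) A j = setT].

Lemma partition_measure (m : {measure set T -> \bar R}) n A (B : set T) :
  finite_partition n A -> measurable B ->
  (\sum_(j < n) m (B `&` A j) = m B)%E.
Proof.
move=> [mA tA AT] mB; rewrite -[in RHS](setIT B) -AT big_distrr/=.
rewrite measure_bigsetU_ord//.
  by move=> j; exact: measurableI.
apply/trivIsetP => i j _ _ ij; move/trivIsetP : tA => /(_ i j I I ij).
by rewrite setIACA => ->; rewrite setI0.
Qed.

Lemma partition_integral (m : {measure set T -> \bar R}) n A (f : T -> \bar R) :
  finite_partition n A -> measurable_fun setT f -> (forall x, 0 <= f x)%E ->
  (\sum_(j < n) \int[m]_(x in A j) f x = \int[m]_x f x)%E.
Proof.
move=> [mA tA AT] mf f0; rewrite -[in RHS]AT -(big_mkord xpredT A).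
rewrite ge0_integral_bigsetU ?big_mkord//.
- exact: iota_uniq.
- exact: sub_trivIset tA.
- by rewrite AT.
Qed.

End finite_partition.

Section quantization.
Context {R : realType} {X : pointedMetricType R} (p : R).
Hypothesis p0 : 0 < p.
Implicit Type mu : probability (borel X) R.

Lemma measurable_powdist (x0 : X) :
  measurable_fun setT (fun x : borel X => (mdist (x : X) x0 `^ p)%:E).
Proof.
apply/measurable_EFinP/(measurableT_comp (measurable_powR p)).
by under eq_fun do rewrite mdistC; exact: measurable_mdist.
Qed.

Lemma powdist_ge0 (x y : X) : (0 <= (mdist x y `^ p)%:E)%E.
Proof. by rewrite lee_fin powR_ge0. Qed.

(** Monotone convergence along an increasing sequence of compact sets that
    exhausts the measure. *)
Lemma radon_tail mu (f : borel X -> \bar R) (e : R) : radon mu ->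
  measurable_fun setT f -> (forall x, 0 <= f x)%E -> (\int[mu]_x f x < +oo)%E ->
  0 < e -> exists K : set X, compact K /\ (\int[mu]_(x in ~` K) f x <= e%:E)%E.
Proof.
move=> rmu mf f0 intf e0.
have /choice[K KP] : forall m : nat, exists K : set X,
    compact K /\ (1 <= mu K + m.+1%:R^-1%:E)%E.
  move=> m; have m0 : 0 < m.+1%:R^-1 :> R by rewrite invr_gt0.
  have [K [cK _ muK]] := radon_compact rmu measurableT m0.
  by exists K; split => //; rewrite -(@probability_setT _ _ _ mu).
pose F m : set (borel X) := \big[setU/set0]_(k < m) K k.
have cF m : compact (F m : set X).
  rewrite /F; elim/big_ind : _ => //; first exact: compact0.
    by move=> A B cA cB; exact: compactU.
  by move=> k _; exact: (KP k).1.
have mF m : measurable (F m) by apply: compact_borel.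
pose N := ~` \bigcup_m F m.
have mU : measurable (\bigcup_m F m) by exact: bigcup_measurable.
have muN : mu N = 0%E.
  apply/eqP; rewrite eq_le measure_ge0 andbT.
  apply/lee_addgt0Pr => eps eps0; have [m me] := inv_nat_lt eps0.
  rewrite add0e (le_trans (y := mu (~` F m.+1)))//.
    apply: le_measure; rewrite ?inE; [exact: measurableC|exact: measurableC|].
    by apply: subsetC; exact: bigcup_sup.
  rewrite probability_setC// leeBlDl; last exact: fin_num_measure.
  apply: le_trans (KP m).2 _; apply: leeD; last by rewrite lee_fin ltW.
  apply: le_measure; rewrite ?inE//; first by apply: compact_borel; exact: (KP m).1.
  by rewrite /F big_ord_recr/=; exact: subsetUr.
have mfS A : measurable_fun A f by exact: measurable_funS mf.
have intU : (\int[mu]_x f x = \int[mu]_(x in \bigcup_m F m) f x)%E.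
  rewrite -(setUv (\bigcup_m F m)) ge0_integral_setU//; last 2 first.
    exact: measurableC.
    by apply/disj_setPS; rewrite setICr.
  rewrite [X in (_ + X)%E](_ : _ = 0%E) ?adde0//.
  by apply: null_set_integral => //; exact: measurableC.
have := @ge0_nondecreasing_set_cvg_integral _ _ _ F f mu _ mF.
rewrite -intU => cvF.
have {}cvF : (\int[mu]_(x in F i) f x)%E @[i --> \oo] --> (\int[mu]_x f x)%E.
  apply: cvF => // i j ij; apply/subsetPset; exact: subset_bigsetU.
have Jfin : (\int[mu]_x f x)%E \is a fin_num.
  by rewrite ge0_fin_numE// integral_ge0.
have Je : (\int[mu]_x f x - e%:E < \int[mu]_x f x)%E.
  by rewrite lteBlDr// lteDl// lte_fin.
have [m _ /(_ m (leqnn m)) mP] := cvF _ (open_ereal_gt' Je).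
exists (F m); split => //.
have : (\int[mu]_x f x = \int[mu]_(x in F m) f x + \int[mu]_(x in ~` F m) f x)%E.
  rewrite -[in LHS](setUv (F m)) ge0_integral_setU//; first exact: measurableC.
  by apply/disj_setPS; rewrite setICr.
move=> JE; move: mP; rewrite /= {1}JE => mP.
have fF : (\int[mu]_(x in F m) f x)%E \is a fin_num.
  rewrite ge0_fin_numE ?integral_ge0//; apply: le_lt_trans intf.
  by rewrite JE leeDl// integral_ge0.
by move: mP; rewrite -addeA gteDl// EFinN suber_lt0// => /ltW.
Qed.

(** Outside of a large compact set every point is sent to the base point of the
    moment condition, at a cost controlled by the tail of that moment; the
    compact set is cut along the balls of a fine finite net. *)
Lemma quantization mu (e : R) : radon mu -> finite_moment p mu -> 0 < e ->
  exists n (A : nat -> set (borel X)) (y : nat -> X),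
    finite_partition n A /\ (\sum_(j < n) \int[mu]_(x in A j) (mdist (x : X) (y j) `^ p)%:E <= e%:E)%E.
Proof.
move=> rmu [x0 mx0] e0; have e20 : 0 < e / 2 by rewrite divr_gt0.
have mx0' : (\int[mu]_x (mdist (x : X) x0 `^ p)%:E < +oo)%E.
  by under eq_integral do rewrite mdistC.
have [K [cK Ke]] := radon_tail rmu (measurable_powdist x0) (powdist_ge0^~ x0) mx0' e20.
pose r := (e / 2) `^ p^-1; have r0 : 0 < r by rewrite powR_gt0.
have [s [_ sK]] := compact_net cK r0.
(* The pieces of the compact set are shifted by one: piece 0 is its complement. *)
pose B j : set (borel X) := if j is i.+1 then mball (nth point s i) r else ~` K.
have mB j : measurable (B j).
  by case: j => [|j]; [apply: measurableC; exact: compact_borel|exact: measurable_mball].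
pose y j := if j is i.+1 then nth point s i else x0.
have AP : finite_partition (size s).+1 (seqDU B).
  split.
  - by move=> j; apply: measurableD => //; exact: bigsetU_measurable.
  - exact: trivIset_seqDU.
  - rewrite -bigsetU_seqDU; apply/seteqP; split => // x _.
    have [Kx|nKx] := pselect (K x); last by rewrite big_ord_recl; left.
    have [z zs zx] := sK x Kx; rewrite -bigcup_mkord.
    exists (index z s).+1; first by rewrite /= ltnS index_mem.
    by rewrite /B/= nth_index.
exists (size s).+1, (seqDU B), y; split => //.
have [mA tA AT] := AP.
have AB j : seqDU B j `<=` B j by move=> x [].
have mf z A : measurable_fun A (fun x : borel X => (mdist (x : X) z `^ p)%:E).
  by apply: measurable_funS (measurable_powdist z).
rewrite big_ord_recl [e]splitr EFinD; apply: leeD.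
  apply: le_trans Ke; apply: ge0_subset_integral => //.
  - by apply: measurableC; exact: compact_borel.
  - by move=> x _; exact: powdist_ge0.
apply: (@le_trans _ _ (\sum_(j < size s) (e / 2)%:E * mu (seqDU B j.+1))%E).
  apply: lee_sum => j _; rewrite -integral_cst//; apply: ge0_le_integral => //.
  - by move=> x _; exact: powdist_ge0.
  - move=> x /AB /= xr; rewrite lee_fin (_ : e / 2 = r `^ p); last first.
      by rewrite -powRrM mulVf ?gt_eqF// powRr1// ltW.
    apply: ge0_ler_powR; rewrite ?nnegrE ?(ltW p0) ?mdist_ge0// ?(ltW r0)//.
    by rewrite mdistC ltW.
rewrite -ge0_sume_distrr; last by move=> j _; exact: measure_ge0.
apply: (@le_trans _ _ ((e / 2)%:E * 1)%E); last by rewrite mule1.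
apply: lee_wpmul2l; first by rewrite lee_fin ltW.
rewrite -(@probability_setT _ _ _ mu) -(partition_measure mu AP measurableT).
rewrite big_ord_recl; apply: le_trans (leeDr _ _); last exact: measure_ge0.
by apply: lee_sum => j _; rewrite setTI.
Qed.

End quantization.

(** * Gluing two couplings *)

(** The complement of [D] is null for the restriction, and on [D] the two
    measures agree. *)
Lemma ge0_integral_mrestr d (T : measurableType d) (R : realType)
    (m : {measure set T -> \bar R}) (D : set T) (mD : measurable D)
    (f : T -> \bar R) : measurable_fun setT f -> (forall x, 0 <= f x)%E ->
  (\int[mrestr m mD]_x f x = \int[m]_(x in D) f x)%E.
Proof.
move=> mf f0; have mfS B : measurable_fun B f by exact: measurable_funS mf.
rewrite -(setUv D) ge0_integral_setU//; last 2 first.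
  exact: measurableC.
  by apply/disj_setPS; rewrite setICr.
rewrite [X in (_ + X)%E]null_set_integral ?adde0//; last 2 first.
  exact: measurableC.
  by rewrite /= /mrestr setICl measure0.
apply: eq_measure_integral => B mB BD.
by rewrite /= /mrestr (setIidl BD).
Qed.

Section slice.
Context {R : realType} {X : pointedMetricType R}.
Variables (gamma : probability (borel (X * X)) R).

Let first (z : borel (X * X)) : borel X := (z : X * X).1.
Let second (z : borel (X * X)) : borel X := (z : X * X).2.

(** The part of the first marginal of [gamma] that [gamma] transports into
    [A]. *)
Definition slice (A : set (borel X)) (B : set (borel X)) : \bar R :=
  gamma (first @^-1` B `&` second @^-1` A).

Variables (A : set (borel X)) (mA : measurable A).

Let mfirst : measurable_fun setT first.
Proof. exact: measurable_fst_borel. Qed.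

Let mA2 : measurable (second @^-1` A).
Proof. by rewrite -[X in measurable X]setTI; exact: measurable_snd_borel. Qed.

Let slice_measure : measure (borel X) R :=
  @measure_function_pushforward__canonical__measure_function_Measure
    _ _ _ _ R (mrestr gamma mA2) first mfirst.

HB.instance Definition _ := isMeasure.Build _ _ _ (slice A)
  (@measure0 _ _ _ slice_measure) (@measure_ge0 _ _ _ slice_measure)
  (@measure_semi_sigma_additive _ _ _ slice_measure).

Let slice_fin : fin_num_fun (slice A).
Proof.
move=> B mB; apply: fin_num_measure; apply: measurableI => //.
by rewrite -[X in measurable X]setTI; exact: measurable_fst_borel.
Qed.

HB.instance Definition _ := Measure_isFinite.Build _ _ _ (slice A) slice_fin.

Definition slice_finite : {finite_measure set (borel X) -> \bar R} := slice A.

Lemma ge0_integral_slice (f : borel X -> \bar R) : measurable_fun setT f ->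
  (forall x, 0 <= f x)%E ->
  (\int[slice A]_x f x = \int[gamma]_(z in second @^-1` A) f (first z))%E.
Proof.
move=> mf f0.
rewrite [LHS](_ : _ = \int[pushforward (mrestr gamma mA2) first]_x f x)%E//.
rewrite ge0_integral_pushforward//= preimage_setT.
rewrite ge0_integral_mrestr//; exact: measurableT_comp.
Qed.

End slice.

Section slices_of_coupling.
Context {R : realType} {X : pointedMetricType R} (p : R).
Hypothesis p1 : 1 <= p.
Variables (mu nu : probability (borel X) R) (gamma : probability (borel (X * X)) R).
Hypothesis cg : coupling mu nu gamma.
Variables (D : nat -> X) (n : nat) (A : nat -> set (borel X)).
Hypothesis muD : mu (approx_by D) = 1%E.
Hypothesis PA : finite_partition n A.

Let p0 : 0 < p. Proof. exact: lt_le_trans p1. Qed.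
Let mA j : measurable (A j). Proof. by case: PA. Qed.

Let mD : measurable (approx_by D : set (borel X)).
Proof. exact: measurable_approx_by. Qed.

Let mret (B : set (borel X)) : measurable B ->
  measurable (retract D @^-1` B : set (borel X)).
Proof. by move=> mB; rewrite -[X in measurable X]setTI; exact: measurable_retract. Qed.

Let muDC : mu (~` approx_by D) = 0%E.
Proof. by rewrite probability_setC// muD subee. Qed.

Let A2 j : set (borel (X * X)) := (fun z : X * X => z.2) @^-1` (A j).

Let PA2 : finite_partition n A2.
Proof.
case: PA => _ tA AT; split.
- by move=> j; rewrite -[X in measurable X]setTI; exact: measurable_snd_borel.
- apply/trivIsetP => i j _ _ ij; move/trivIsetP : tA => /(_ i j I I ij) Aij.
  by rewrite /A2 -preimage_setI Aij preimage_set0.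
- apply/seteqP; split => // z _.
  have : (\big[setU/set0]_(j < n) A j) (z : X * X).2 by rewrite AT.
  by rewrite -!bigcup_mkord => -[j jn Aj]; exists j.
Qed.

Let mA2 j : measurable (A2 j).
Proof. by case: PA2. Qed.

Lemma measure_retract (B : set (borel X)) : measurable B ->
  mu (retract D @^-1` B) = mu B.
Proof.
move=> mB.
have E (C : set (borel X)) : measurable C -> mu C = mu (C `&` approx_by D).
  move=> mC; rewrite -[in LHS](setIT C) -(setUv (approx_by D)) setIUr measureU//.
  - rewrite [X in (_ + X)%E](_ : _ = 0%E) ?adde0//.
    apply/eqP; rewrite eq_le measure_ge0 andbT -[leRHS]muDC.
    apply: le_measure; rewrite ?inE//; last exact: measurableC.
    by apply: measurableI => //; exact: measurableC.
  - exact: measurableI.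
  - by apply: measurableI => //; exact: measurableC.
  - by rewrite setIACA setICr setI0.
rewrite E; last exact: mret.
rewrite [RHS]E//; congr (mu _); apply/seteqP.
by split => x [/= Bx Dx]; split => //; move: Bx; rewrite retract_id.
Qed.

Lemma slice_setT (B : set (borel X)) : measurable B -> slice gamma B setT = nu B.
Proof.
move=> mB; rewrite /slice preimage_setT setTI.
exact: (coupling_setT2 cg).
Qed.

Lemma sum_slice_retract (B : set (borel X)) : measurable B ->
  (\sum_(j < n) slice gamma (A j) (retract D @^-1` B) = mu B)%E.
Proof.
move=> mB; rewrite -(measure_retract mB) -(coupling_setT1 cg (mret mB)).
rewrite -(partition_measure _ PA2)//.
by rewrite -[X in measurable X]setTI; apply: measurable_fst_borel => //; exact: mret.
Qed.

(** The cost of the coupling [gamma] after its second coordinate has been moved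
    to the point [y j] of the piece [A j] that contains it.  The retraction does
    not change the integrals, since it is almost surely the identity. *)
Lemma sum_slice_powdist (a e : R) (y : nat -> X) : 0 < a -> 0 < e ->
  (transport_cost p gamma <= (a `^ p)%:E)%E ->
  (\sum_(j < n) \int[nu]_(x in A j) (mdist (x : X) (y j) `^ p)%:E <= (e `^ p)%:E)%E ->
  (\sum_(j < n) \int[slice gamma (A j)]_x (mdist (retract D x) (y j) `^ p)%:E <=
    ((a + e) `^ p)%:E)%E.
Proof.
move=> a0 e0 ca ce; have ae0 : 0 < a + e by rewrite addr_gt0.
set C1 := ((a + e) / a) `^ (p - 1); set C2 := ((a + e) / e) `^ (p - 1).
have C10 : 0 <= C1 by exact: powR_ge0.
have C20 : 0 <= C2 by exact: powR_ge0.
pose f1 j (z : borel (X * X)) : \bar R := (mdist (z : X * X).1 (y j) `^ p)%:E.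
pose f2 j (z : borel (X * X)) : \bar R := (mdist (z : X * X).2 (y j) `^ p)%:E.
pose g (z : borel (X * X)) : \bar R := (mdist (z : X * X).1 (z : X * X).2 `^ p)%:E.
have mg B : measurable_fun B g by apply: measurable_funS (@measurable_mdist2 _ X p).
have mf1 j B : measurable_fun B (f1 j).
  apply: (@measurable_funS _ _ _ _ setT) => //.
  exact: (measurableT_comp (measurable_powdist p (y j)) (@measurable_fst_borel _ X)).
have mf2 j B : measurable_fun B (f2 j).
  apply: (@measurable_funS _ _ _ _ setT) => //.
  exact: (measurableT_comp (measurable_powdist p (y j)) (@measurable_snd_borel _ X)).
have ret1 j : (\int[slice gamma (A j)]_x (mdist (retract D x) (y j) `^ p)%:E =
    \int[gamma]_(z in A2 j) f1 j z)%E.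
  have mr : measurable_fun setT
      (fun x : borel X => (mdist (retract D x) (y j) `^ p)%:E).
    exact: (measurableT_comp (measurable_powdist p (y j)) (@measurable_retract _ X D)).
  rewrite ge0_integral_slice//; last by move=> x; exact: powdist_ge0.
  apply: ge0_ae_eq_integral => //.
  - exact: (mA2 j).
  - apply: (@measurable_funS _ _ _ _ setT) => //.
    exact: (measurableT_comp mr (@measurable_fst_borel _ X)).
  - by move=> z _; exact: powdist_ge0.
  - by move=> z _; exact: powdist_ge0.
  - exists ((fun z : X * X => z.1) @^-1` (~` approx_by D)); split.
    + rewrite -[X in measurable X]setTI; apply: measurable_fst_borel => //.
      exact: measurableC.
    + have mDC : measurable (~` approx_by D : set (borel X)) by exact: measurableC.
      by apply: (etrans (coupling_setT1 cg mDC)).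
    + by move=> z /= nz Dz; apply: nz => _; rewrite retract_id.
have int2 j : (\int[gamma]_(z in A2 j) f2 j z =
    \int[nu]_(x in A j) (mdist (x : X) (y j) `^ p)%:E)%E.
  pose m2 : measure (borel X) R :=
    @measure_function_pushforward__canonical__measure_function_Measure
      _ _ _ _ R gamma _ (@measurable_snd_borel _ X).
  rewrite [RHS](@eq_measure_integral _ _ _ _ m2).
    rewrite (ge0_integral_pushforward (@measurable_snd_borel _ X))//.
    - by apply: measurable_funS (measurable_powdist p (y j)).
    - by move=> z _; exact: powdist_ge0.
  by move=> B mB _; rewrite /m2/= /pushforward (coupling_setT2 cg mB).
apply: (@le_trans _ _ (\sum_(j < n) (C1%:E * \int[gamma]_(z in A2 j) g z +
    C2%:E * \int[nu]_(x in A j) (mdist (x : X) (y j) `^ p)%:E))%E).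
  apply: lee_sum => j _; rewrite ret1 -int2.
  rewrite -!ge0_integralZl//; try by move=> z _; exact: powdist_ge0.
  rewrite -ge0_integralD//.
  - apply: ge0_le_integral => //.
    + by move=> z _; exact: powdist_ge0.
    + by apply: emeasurable_funD; apply: measurable_funeM.
    + move=> z _; rewrite -!EFinM -EFinD lee_fin.
      apply: le_trans (powR_split p1 a0 e0 (mdist_ge0 _ _) (mdist_ge0 _ _)).
      apply: ge0_ler_powR; rewrite ?nnegrE ?(ltW p0) ?addr_ge0 ?mdist_ge0//.
      exact: mdist_triangle.
  - by move=> z _; apply: mule_ge0 => //; exact: powdist_ge0.
  - exact: measurable_funeM.
  - by move=> z _; apply: mule_ge0 => //; exact: powdist_ge0.
  - exact: measurable_funeM.
rewrite big_split/= -!ge0_sume_distrr; last 2 first.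
- by move=> j _; apply: integral_ge0 => z _; exact: powdist_ge0.
- by move=> j _; apply: integral_ge0 => z _; exact: powdist_ge0.
rewrite partition_integral//; last by move=> z; exact: powdist_ge0.
rewrite -(powR_splitE p1 a0 e0) EFinD !EFinM.
by apply: leeD; apply: lee_wpmul2l.
Qed.

End slices_of_coupling.

Section product_marginals.
Context {d1 d2} {T1 : measurableType d1} {T2 : measurableType d2} {R : realType}.
Variables (m1 : {finite_measure set T1 -> \bar R}) (m2 : {finite_measure set T2 -> \bar R}).

Lemma ge0_integral_prod_fst (f : T1 -> \bar R) : measurable_fun setT f ->
  (forall x, 0 <= f x)%E ->
  (\int[m1 \x m2]_z f z.1 = \int[m1]_x f x * m2 setT)%E.
Proof.
move=> mf f0; rewrite fubini_tonelli1//; last first.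
  by apply: measurableT_comp => //; exact: measurable_fst.
rewrite -ge0_integralZr//; apply: eq_integral => x _.
by rewrite /fubini_F/= integral_cst.
Qed.

Lemma ge0_integral_prod_snd (f : T2 -> \bar R) : measurable_fun setT f ->
  (forall x, 0 <= f x)%E ->
  (\int[m1 \x m2]_z f z.2 = m1 setT * \int[m2]_x f x)%E.
Proof.
move=> mf f0; rewrite fubini_tonelli2//; last first.
  by apply: measurableT_comp => //; exact: measurable_snd.
rewrite muleC -ge0_integralZr//; apply: eq_integral => x _.
by rewrite /fubini_G/= integral_cst.
Qed.

End product_marginals.

Section gluing.
Context {R : realType} {X : pointedMetricType R} (p : R).
Hypothesis p1 : 1 <= p.

(** The usual gluing lemma disintegrates both couplings with respect to their
    common marginal [nu].  Here [nu] is only cut into finitely many pieces [A j]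
    of negligible size, and over each piece the slices of the two couplings are
    multiplied: the result still has the marginals [mu] and [rho], and the cost
    of going through the point [y j] instead of an arbitrary point of [A j] is
    absorbed by [e]. *)
Lemma cost_le_glue (mu nu rho : probability (borel X) R) (a b e : R) :
  radon mu -> radon nu -> radon rho -> finite_moment p nu ->
  0 < a -> 0 < b -> 0 < e ->
  cost_le p mu nu (a `^ p) -> cost_le p nu rho (b `^ p) ->
  cost_le p mu rho ((a + b + e) `^ p).
Proof.
move=> rmu rnu rrho mnu a0 b0 e0 [g1 cg1 g1a] /cost_le_sym[g2 cg2 g2b].
have p0 : 0 < p by exact: lt_le_trans p1.
have e20 : 0 < e / 2 by rewrite divr_gt0.
have [n [A [y [PA Ae]]]] := quantization p0 rnu mnu (powR_gt0 p e20).
have [D muD] := radon_separable rmu; have [E rhoE] := radon_separable rrho.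
have [mA _ _] := PA.
pose w j := nu (A j); have w0 j : (0 <= w j)%E by exact: measure_ge0.
have fw j : w j \is a fin_num by exact: fin_num_measure.
have iw0 j : 0 <= (fine (w j))^-1 by rewrite invr_ge0 fine_ge0.
pose s1 j := slice_finite g1 (mA j); pose s2 j := slice_finite g2 (mA j).
have s1T j : s1 j setT = w j by exact: (slice_setT cg1).
have s2T j : s2 j setT = w j by exact: (slice_setT cg2).
(* Division by the mass of a null piece is harmless: the slices vanish there. *)
have cancel (s : {finite_measure set (borel X) -> \bar R}) j (x : \bar R) :
    s setT = w j -> (0 <= x)%E -> (w j = 0 -> x = 0)%E ->
    ((fine (w j))^-1%:E * (x * w j) = x)%E.
  move=> sT x0 wx; have [wj0|wj0] := eqVneq (w j) 0%E.
    by rewrite wj0 mule0 mule0 wx.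
  rewrite muleCA -[in X in (_ * (_ * X))%E](fineK (fw j)) -EFinM mulVf ?mule1//.
  by rewrite fine_eq0.
pose m j : {measure set (borel X * borel X) -> \bar R} :=
  mscale (NngNum (iw0 j)) (s1 j \x s2 j)%E.
pose phi (z : borel X * borel X) : borel (X * X) := (retract D z.1, retract E z.2).
have mphi : measurable_fun setT phi by exact: measurable_retract_pair.
have mret (F : nat -> X) (B : set (borel X)) : measurable B ->
    measurable (retract F @^-1` B : set (borel X)).
  by move=> mB; rewrite -[X in measurable X]setTI; exact: measurable_retract.
have mE j B C : measurable B -> measurable C ->
    m j (B `*` C) = ((fine (w j))^-1%:E * (s1 j B * s2 j C))%E.
  by move=> mB mC; rewrite /m/= /mscale/= product_measure1E.
have le_w (s : {finite_measure set (borel X) -> \bar R}) j B : s setT = w j ->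
    measurable B -> (w j = 0 -> s B = 0)%E.
  move=> sT mB wj0; apply/eqP; rewrite eq_le measure_ge0 andbT -wj0 -sT.
  by apply: le_measure; rewrite ?inE.
apply: (@cost_le_mixture _ _ _ _ _ _ _ n m (fun=> phi)).
- by move=> _; exact: mphi.
- move=> B mB; rewrite -(sum_slice_retract cg1 muD PA mB).
  apply: eq_bigr => j _; rewrite -[RHS](cancel (s1 j) j)//.
  + rewrite (_ : (_ @^-1` B) = (retract D @^-1` B) `*` setT); last first.
      by apply/seteqP; split => z //= [].
    by rewrite mE ?s2T//; exact: mret.
  + exact: (@measure_ge0 _ _ _ (s1 j)).
  + by apply: (le_w (s1 j)) => //; exact: mret.
- move=> B mB; rewrite -(sum_slice_retract cg2 rhoE PA mB).
  apply: eq_bigr => j _; rewrite -[RHS](cancel (s2 j) j)//.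
  + rewrite (_ : (_ @^-1` B) = setT `*` (retract E @^-1` B)); last first.
      by apply/seteqP; split => z //= [].
    by rewrite mE ?s1T 1?(muleC (w j))//; exact: mret.
  + exact: (@measure_ge0 _ _ _ (s2 j)).
  + by apply: (le_w (s2 j)) => //; exact: mret.
pose a' := a + e / 2; pose b' := b + e / 2.
have a'0 : 0 < a' by rewrite addr_gt0.
have b'0 : 0 < b' by rewrite addr_gt0.
have -> : a + b + e = a' + b' by rewrite /a' /b'; field.
have S1 := sum_slice_powdist p1 cg1 muD PA a0 e20 g1a Ae.
have S2 := sum_slice_powdist p1 cg2 rhoE PA b0 e20 g2b Ae.
set C1 := ((a' + b') / a') `^ (p - 1); set C2 := ((a' + b') / b') `^ (p - 1).
have C10 : 0 <= C1 by exact: powR_ge0.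
have C20 : 0 <= C2 by exact: powR_ge0.
pose f1 j (x : borel X) : \bar R := (mdist (retract D x) (y j) `^ p)%:E.
pose f2 j (x : borel X) : \bar R := (mdist (retract E x) (y j) `^ p)%:E.
have mf1 j : measurable_fun setT (f1 j).
  exact: (measurableT_comp (measurable_powdist p (y j)) (@measurable_retract _ X D)).
have mf2 j : measurable_fun setT (f2 j).
  exact: (measurableT_comp (measurable_powdist p (y j)) (@measurable_retract _ X E)).
have f10 j x : (0 <= f1 j x)%E by exact: powdist_ge0.
have f20 j x : (0 <= f2 j x)%E by exact: powdist_ge0.
have m1 j : measurable_fun setT (fun z : borel X * borel X => f1 j z.1).
  by apply: measurableT_comp => //; exact: measurable_fst.
have m2 j : measurable_fun setT (fun z : borel X * borel X => f2 j z.2).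
  by apply: measurableT_comp => //; exact: measurable_snd.
have int1 j : (\int[m j]_z f1 j z.1 = \int[s1 j]_x f1 j x)%E.
  rewrite ge0_integral_mscale//= ge0_integral_prod_fst// s2T.
  apply: (cancel (s1 j)) => //; first exact: integral_ge0.
  move=> wj0; apply: null_set_integral => //.
  by apply: etrans (s1T j) _.
have int2 j : (\int[m j]_z f2 j z.2 = \int[s2 j]_x f2 j x)%E.
  rewrite ge0_integral_mscale//= ge0_integral_prod_snd// s1T (muleC (w j)).
  apply: (cancel (s2 j)) => //; first exact: integral_ge0.
  move=> wj0; apply: null_set_integral => //.
  by apply: etrans (s2T j) _.
apply: (@le_trans _ _ (\sum_(j < n) (C1%:E * \int[s1 j]_x f1 j x +
    C2%:E * \int[s2 j]_x f2 j x))%E).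
  apply: lee_sum => j _; rewrite -int1 -int2.
  rewrite -!ge0_integralZl//.
  rewrite -ge0_integralD//.
  - apply: ge0_le_integral => //.
    + by move=> z _; exact: powdist_ge0.
    + exact: (measurableT_comp (@measurable_mdist2 _ X p) mphi).
    + by apply: emeasurable_funD; apply: measurable_funeM.
    + move=> z _; rewrite -!EFinM -EFinD lee_fin.
      apply: le_trans (powR_split p1 a'0 b'0 (mdist_ge0 _ _) (mdist_ge0 _ _)).
      apply: ge0_ler_powR; rewrite ?nnegrE ?(ltW p0) ?addr_ge0 ?mdist_ge0//.
      by rewrite (mdistC (retract E _)); exact: mdist_triangle.
  - by move=> z _; apply: mule_ge0.
  - exact: measurable_funeM.
  - by move=> z _; apply: mule_ge0.
  - exact: measurable_funeM.
rewrite big_split/= -!ge0_sume_distrr; last 2 first.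
- by move=> j _; apply: integral_ge0.
- by move=> j _; apply: integral_ge0.
rewrite -(powR_splitE p1 a'0 b'0) EFinD !EFinM.
by apply: leeD; apply: lee_wpmul2l.
Qed.

End gluing.

(** * The Wasserstein distance as a pseudometric *)

Section Wp_pseudometric.
Context {R : realType} {X : pointedMetricType R} (p : R).
Hypothesis p1 : 1 <= p.
Implicit Types mu nu rho : Pp X p.

Let p0 : 0 < p. Proof. exact: lt_le_trans p1. Qed.

Lemma unifE N (x : nat -> X) (A : set (borel X)) :
  unif N x p A = (\sum_(j < N.+1) (N.+1%:R^-1 : R)%:E * \d_(x j : borel X) A)%E.
Proof.
rewrite /unif/= /unif_measure /mscale/= /msum ge0_sume_distrr//.
Qed.

Lemma dirac_unif (x : X) (A : set (borel X)) :
  unif 0 (fun=> x) p A = \d_(x : borel X) A.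
Proof. by rewrite unifE big_ord1 invr1 mul1e. Qed.

Let cost_le_dirac mu : exists (x : X) (C : R), cost_le p mu (unif 0 (fun=> x) p) C.
Proof.
have [x mx] := Pp_moment mu.
pose J := (\int[mu]_y (mdist (y : X) x `^ p)%:E)%E.
have Jfin : J \is a fin_num.
  rewrite ge0_fin_numE; last by apply: integral_ge0 => y _; exact: powdist_ge0.
  by rewrite /J; under eq_integral do rewrite mdistC.
exists x, (fine J).
apply: (@cost_le_mixture _ _ _ _ _ _ (borel X) 1 (fun=> Pp_prob mu) (fun=> fun y => (y, x))).
- by move=> _; exact: measurable_pair_borel.
- by move=> A mA; rewrite big_ord1.
- move=> A mA; rewrite big_ord1 dirac_unif diracE.
  have [xA|xA] := boolP (x \in A).
    rewrite (_ : _ @^-1` A = setT).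
      exact: (@probability_setT _ _ _ (Pp_prob mu)).
    by apply/seteqP; split => // y _ /=; rewrite inE in xA.
  rewrite (_ : _ @^-1` A = set0).
    exact: (@measure0 _ _ _ (Pp_prob mu)).
  by apply/seteqP; split => // y /= yA; rewrite notin_setE in xA.
by rewrite big_ord1/= fineK.
Qed.

Let cost_le_dirac2 (x y : X) :
  cost_le p (unif 0 (fun=> x) p) (unif 0 (fun=> y) p) (mdist x y `^ p).
Proof.
apply: (@cost_le_mixture _ _ _ _ _ _ (borel (X * X)) 1
    (fun=> \d_((x, y) : borel (X * X))) (fun=> id)).
- by move=> _; exact: measurable_id.
- by move=> A mA; rewrite big_ord1 dirac_unif !diracE; congr (_%:R%:E);
    congr nat_of_bool; apply/idP/idP; rewrite !inE.
- by move=> A mA; rewrite big_ord1 dirac_unif !diracE; congr (_%:R%:E);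
    congr nat_of_bool; apply/idP/idP; rewrite !inE.
rewrite big_ord1 integral_dirac//=; last exact: measurable_mdist2.
by rewrite diracT mul1e.
Qed.

Let cost_le_root (mu nu : probability (borel X) R) C : cost_le p mu nu C ->
  exists2 a, 0 < a & cost_le p mu nu (a `^ p).
Proof.
move=> muC; have C0 : 0 < Num.max C 1 by rewrite lt_max ltr01 orbT.
exists (Num.max C 1 `^ p^-1); first by rewrite powR_gt0.
rewrite -powRrM mulVf ?gt_eqF// powRr1 ?(ltW C0)//.
by apply: cost_le_trans muC; rewrite le_max lexx.
Qed.

(** Go from [mu] to a Dirac mass, to another Dirac mass, and to [nu]: the costs
    are the moments of [mu] and [nu] and a distance. *)
Lemma cost_le_exists mu nu : exists C : R, cost_le p mu nu C.
Proof.
have [x [C /cost_le_root[a a0 muC]]] := cost_le_dirac mu.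
have [y [D /cost_le_root[b b0 nuD]]] := cost_le_dirac nu.
have /cost_le_root[c c0 xy] := cost_le_dirac2 x y.
have rad (z : X) : radon (unif 0 (fun=> z) p) by exact: Pp_radon.
have mom (z : X) : finite_moment p (unif 0 (fun=> z) p) by exact: Pp_moment.
have muy := cost_le_glue p1 (Pp_radon mu) (rad x) (rad y) (mom x) a0 c0 ltr01 muC xy.
have ac0 : 0 < a + c + 1 by rewrite !addr_gt0.
eexists; exact: (cost_le_glue p1 (Pp_radon mu) (rad y) (Pp_radon nu) (mom y) ac0
  b0 ltr01 muy (cost_le_sym nuD)).
Qed.

Lemma Wp_cost_le mu nu c : Wp mu nu < c -> cost_le p mu nu (c `^ p).
Proof. by have [C muC] := cost_le_exists mu nu; exact: Wp_lt muC. Qed.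

Lemma WpC mu nu : Wp mu nu = Wp nu mu.
Proof.
have W mu' nu' : Wp mu' nu' <= Wp nu' mu'.
  apply/ler_addgt0Pr => e e0; apply: Wp_le => //; first by rewrite addr_ge0 ?Wp_ge0 ?ltW.
  by apply: cost_le_sym; apply: Wp_cost_le; rewrite ltrDl.
by apply/eqP; rewrite eq_le !W.
Qed.

Lemma Wpxx mu : Wp mu mu = 0.
Proof.
apply/eqP; rewrite eq_le Wp_ge0 andbT; apply: Wp_le => //.
by rewrite powR0 ?gt_eqF//; exact: cost_le_refl.
Qed.

Lemma Wp_triangle mu nu rho : Wp mu rho <= Wp mu nu + Wp nu rho.
Proof.
apply/ler_addgt0Pr => e e0; have e3 : 0 < e / 3 by rewrite divr_gt0.
have W0 := Wp_ge0 mu nu; have W0' := Wp_ge0 nu rho.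
apply: Wp_le => //; first by rewrite !addr_ge0// ltW.
have -> : Wp mu nu + Wp nu rho + e =
    (Wp mu nu + e / 3) + (Wp nu rho + e / 3) + e / 3 by field.
apply: (cost_le_glue p1 _ (Pp_radon nu)) => //; try exact: Pp_radon.
- exact: Pp_moment.
- by rewrite ltr_wpDl.
- by rewrite ltr_wpDl.
- by apply: Wp_cost_le; rewrite ltrDl.
- by apply: Wp_cost_le; rewrite ltrDl.
Qed.

End Wp_pseudometric.

(** * Density of the uniform measures *)

Section uniform_dense.
Context {R : realType} {X : pointedMetricType R} (p : R).
Hypothesis p1 : 1 <= p.

Let p0 : 0 < p. Proof. exact: lt_le_trans p1. Qed.

Lemma sum_index_seq (V : nmodType) (F : nat -> V) (k : nat -> nat) (n L : nat) :
  let s := flatten [seq nseq (k j) j | j <- iota 0 n] ++ nseq L 0%N in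
  \sum_(l < size s) F (nth 0%N s l) = \sum_(j < n) F j *+ k j + F 0%N *+ L.
Proof.
move=> s; rewrite -(big_mkord xpredT (fun l => F (nth 0%N s l))) -(big_nth 0%N xpredT F).
rewrite big_cat big_nseq iter_addr_0 big_flatten/= big_map; congr (_ + _).
rewrite -(big_mkord xpredT (fun j => F j *+ k j)) /index_iota subn0; apply: eq_bigr => j _.
by rewrite big_nseq iter_addr_0.
Qed.

(** Round the masses of the pieces down to multiples [k j / (N + 1)], and send
    what is left, of mass at most [1 / (N + 1)] in each piece, to [y 0].  The
    distance from [x] in [A j] to [y 0] is bounded by way of [y j]: the first
    summand of the bound collects the displacements inside the pieces, the second
    one those from [y j] to [y 0]. *)
Lemma unif_approx (mu : Pp X p) (n : nat) (A : nat -> set (borel X)) (y : nat -> X) N :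
  finite_partition n A ->
  exists z : nat -> X,
  (forall e, \sum_(j < n) \int[mu]_(x in A j) (mdist (x : X) (y j) `^ p)%:E <= e%:E ->
    cost_le p mu (unif N z p) ((1 + 2 `^ (p - 1)) * e +
      2 `^ (p - 1) * (\sum_(j < n) mdist (y j) (y 0%N) `^ p) / N.+1%:R))%E.
Proof.
move=> PA; have [mA _ _] := PA.
have fA j : mu (A j) \is a fin_num by exact: fin_num_measure.
pose w j := fine (mu (A j)); have w0 j : 0 <= w j by exact: fine_ge0.
have wE j : mu (A j) = (w j)%:E by rewrite fineK.
have sumw : \sum_(j < n) w j = 1.
  apply: EFin_inj; rewrite -sumEFin.
  apply: etrans (@probability_setT _ _ _ (Pp_prob mu)).
  apply: etrans (partition_measure (Pp_prob mu) PA measurableT).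
  by apply: eq_bigr => j _; rewrite setTI; exact: esym (wE j).
pose k j := Num.truncn (N.+1%:R * w j).
have kw j : (k j)%:R <= N.+1%:R * w j by rewrite truncn_le// mulr_ge0.
have wk j : N.+1%:R * w j < (k j).+1%:R by exact: truncnS_gt.
have N0 : 0 < N.+1%:R :> R by [].
have sumk : (\sum_(j < n) k j <= N.+1)%N.
  rewrite -(ler_nat R) natr_sum.
  rewrite [leRHS](_ : _ = \sum_(j < n) N.+1%:R * w j).
    by apply: ler_sum => j _; exact: kw.
  by rewrite -mulr_sumr sumw mulr1.
pose L := (N.+1 - \sum_(j < n) k j)%N.
pose s := flatten [seq nseq (k j) j | j <- iota 0 n] ++ nseq L 0%N.
have ss : size s = N.+1.
  rewrite size_cat size_nseq size_flatten /shape -map_comp sumnE big_map.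
  rewrite (eq_bigr (fun j => k j)) => [|j _]; last by rewrite /= size_nseq.
  by rewrite -[X in iota 0 X]subn0 big_mkord /L subnKC.
exists (fun l => y (nth 0%N s l)) => e Ie.
have unifs (B : set (borel X)) : unif N (fun l => y (nth 0%N s l)) p B =
    (N.+1%:R^-1 * (\sum_(j < n) (y j \in B)%:R *+ k j + (y 0%N \in B)%:R *+ L))%:E.
  rewrite unifE -ge0_sume_distrr//.
  rewrite EFinM -(sum_index_seq (fun j => (y j \in B)%:R)) -/s ss.
  by rewrite -sumEFin; congr (_ * _)%E; apply: eq_bigr => l _; rewrite diracE.
pose th j := (k j)%:R / (N.+1%:R * w j).
have thw j : th j * w j = (k j)%:R / N.+1%:R.
  rewrite /th; have [wj0|wj0] := eqVneq (w j) 0; last by rewrite invfM mulrA mulfVK.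
  have : (k j)%:R <= 0 :> R by rewrite (le_trans (kw j))// wj0 mulr0.
  by rewrite lern0 => /eqP ->; rewrite !mul0r.
have th0 j : 0 <= th j by rewrite divr_ge0// mulr_ge0.
have th1 j : th j <= 1.
  have [wj0|wj0] := eqVneq (w j) 0; first by rewrite /th wj0 mulr0 invr0 mulr0.
  by rewrite ler_pdivrMr ?mul1r// mulr_gt0// lt0r wj0 w0.
have th1' j : 0 <= 1 - th j by rewrite subr_ge0.
pose M1 j : {measure set (borel X) -> \bar R} :=
  mscale (NngNum (th0 j)) (mrestr mu (mA j)).
pose M2 j : {measure set (borel X) -> \bar R} :=
  mscale (NngNum (th1' j)) (mrestr mu (mA j)).
(* The first n terms move the rounded masses to their points, the last n terms
   move the remainders to the point of index 0. *)
pose m j := if (j < n)%N then M1 j else M2 (j - n)%N.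
pose phi j (x : borel X) : borel (X * X) := (x, if (j < n)%N then y j else y 0%N).
have M1E j B : M1 j B = ((th j)%:E * mu (B `&` A j))%E by [].
have M2E j B : M2 j B = ((1 - th j)%:E * mu (B `&` A j))%E by [].
have mS (F : nat -> {measure set (borel X) -> \bar R} -> \bar R) :
    (\sum_(j < n + n) F j (m j) = \sum_(j < n) (F j (M1 j) + F (n + j)%N (M2 j)))%E.
  rewrite big_split_ord/= big_split/=; congr (_ + _)%E.
    by apply: eq_bigr => j _; rewrite /m ltn_ord.
  by apply: eq_bigr => j _; rewrite /m ltnNge leq_addr/= addKn.
have phi1 (j : 'I_n) x : phi j x = (x, y j) by rewrite /phi ltn_ord.
have phi2 (j : 'I_n) x : phi (n + j)%N x = (x, y 0%N) by rewrite /phi ltnNge leq_addr.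
apply: (@cost_le_mixture _ _ _ _ _ _ _ (n + n) m phi).
- by move=> j; exact: measurable_pair_borel.
- move=> B mB; rewrite (mS (fun j M => M ((fst \o phi j) @^-1` B)))/=.
  rewrite -(partition_measure (Pp_prob mu) PA mB); apply: eq_bigr => j _.
  rewrite M1E M2E -ge0_muleDl ?lee_fin// -EFinD addrC subrK.
  exact: mul1e.
- move=> B mB; rewrite (mS (fun j M => M ((snd \o phi j) @^-1` B)))/=.
  have cstE z j : mu (((fun=> z) : borel X -> X) @^-1` B `&` A j) =
      ((z \in B)%:R * w j)%:E.
    have [zB|zB] := boolP (z \in B).
      rewrite (_ : _ @^-1` B = setT) ?setTI ?mul1r//.
      by apply/seteqP; split => // x _ /=; rewrite inE in zB.
    rewrite (_ : _ @^-1` B = set0) ?set0I ?mul0r.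
      exact: (@measure0 _ _ _ (Pp_prob mu)).
    by apply/seteqP; split => // x /= xB; move/negP : zB; rewrite inE.
  rewrite unifs (eq_bigr (fun j : 'I_n =>
    ((y j \in B)%:R * (th j * w j) + (y 0%N \in B)%:R * (w j - th j * w j))%:E)).
    rewrite sumEFin big_split/= -mulr_sumr sumrB sumw; congr EFin.
    under eq_bigr do rewrite thw; under [in X in _ * (1 - X)]eq_bigr do rewrite thw.
    rewrite [RHS]mulrDr mulr_sumr; congr (_ + _).
      by apply: eq_bigr => j _; rewrite -mulr_natr; ring.
    rewrite -mulr_suml -natr_sum /L -[in RHS](mulr_natr (_ \in _)%:R) natrB// [RHS]mulrCA.
    by congr (_ * _); rewrite mulrBr mulVf ?pnatr_eq0// [in RHS]mulrC.
  move=> j _; rewrite M1E M2E.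
  rewrite (_ : (snd \o phi j) = fun=> y j); last by apply/funext => x; rewrite /phi/= ltn_ord.
  rewrite (_ : (snd \o phi (n + j)%N) = fun=> y 0%N); last first.
    by apply/funext => x; rewrite /phi/= ltnNge leq_addr.
  by rewrite !cstE -!EFinM -EFinD; congr EFin; ring.
rewrite (mS (fun j M => \int[M]_t (mdist (phi j t : X * X).1 (phi j t : X * X).2 `^ p)%:E)%E).
set c := 2 `^ (p - 1); have c0 : 0 <= c by exact: powR_ge0.
pose I j := (\int[mu]_(x in A j) (mdist (x : X) (y j) `^ p)%:E)%E.
have I0 j : (0 <= I j)%E by apply: integral_ge0 => x _; exact: powdist_ge0.
pose d j := mdist (y j) (y 0%N) `^ p; have d0 j : 0 <= d j by exact: powR_ge0.
have mf z B : measurable_fun B (fun x : borel X => (mdist (x : X) z `^ p)%:E).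
  by apply: measurable_funS (measurable_powdist p z).
have f0 (x z : X) : (0 <= (mdist x z `^ p)%:E)%E by exact: powdist_ge0.
have leftover j : (1 - th j) * w j <= N.+1%:R^-1.
  rewrite mulrBl mul1r thw lerBlDr.
  rewrite -[X in _ <= X + _]mul1r -mulrDl ler_pdivlMr// mulrC.
  by rewrite (le_trans (ltW (wk j)))// -natr1 addrC.
apply: (@le_trans _ _ (\sum_(j < n) ((1 + c)%:E * I j + (c / N.+1%:R * d j)%:E))%E).
  apply: lee_sum => j _.
  under eq_integral do rewrite phi1/=.
  under [X in (_ + X)%E]eq_integral do rewrite phi2/=.
  rewrite !ge0_integral_mscale// !ge0_integral_mrestr//= -/(I j).
  rewrite (EFinD 1 c) ge0_muleDl ?lee_fin// mul1e -addeA; apply: leeD.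
    by rewrite -[leRHS]mul1e lee_wpmul2r// lee_fin.
  apply: (@le_trans _ _ ((1 - th j)%:E * (c%:E * I j + (c * d j)%:E * mu (A j)))%E).
    apply: lee_wpmul2l; first by rewrite lee_fin.
    rewrite -ge0_integralZl// -integral_cst// -ge0_integralD//.
    - apply: ge0_le_integral => //.
      + by apply: emeasurable_funD => //; exact: measurable_funeM.
      + move=> x _; rewrite -EFinM -EFinD lee_fin.
        have := powR_split p1 (@ltr01 R) ltr01 (mdist_ge0 x (y j)) (mdist_ge0 (y j) (y 0%N)).
        rewrite divr1 -/c => /(le_trans _); apply.
        apply: ge0_ler_powR; rewrite ?nnegrE ?(ltW p0) ?addr_ge0 ?mdist_ge0//.
        exact: mdist_triangle.
    - by move=> x _; rewrite mule_ge0.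
    - exact: measurable_funeM.
    - by move=> x _; rewrite lee_fin mulr_ge0.
  rewrite ge0_muleDr ?mule_ge0 ?lee_fin ?mulr_ge0//; apply: leeD.
    by rewrite -[leRHS]mul1e lee_wpmul2r ?mule_ge0// lee_fin lerBlDr lerDl.
  rewrite wE -!EFinM lee_fin.
  by rewrite mulrCA [leRHS]mulrAC ler_wpM2l// mulr_ge0.
rewrite big_split/= -ge0_sume_distrr// sumEFin -mulr_sumr [in leRHS]EFinD.
apply: leeD; last by rewrite lee_fin mulrAC.
by rewrite EFinM lee_wpmul2l// lee_fin addr_ge0.
Qed.

Lemma unif_dense (mu : Pp X p) (e : R) : 0 < e ->
  exists (N : nat) (z : nat -> X), Wp mu (unif N z p) < e.
Proof.
move=> e0; pose c : R := 2 `^ (p - 1); have c0 : 0 <= c by exact: powR_ge0.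
have e20 : 0 < e / 2 by rewrite divr_gt0.
pose E := (e / 2) `^ p; have E0 : 0 < E by rewrite powR_gt0.
have c1 : 0 < 1 + c by rewrite ltr_pwDl.
have E10 : 0 < E / 2 / (1 + c) by rewrite !divr_gt0.
have [n [A [y [PA Ae]]]] := quantization p0 (Pp_radon mu) (Pp_moment mu) E10.
pose D := \sum_(j < n) mdist (y j) (y 0%N) `^ p.
have D0 : 0 <= D by apply: sumr_ge0 => j _; exact: powR_ge0.
have cD1 : 0 < c * D + 1 by rewrite ltr_wpDl// mulr_ge0.
have [N NE] : exists N : nat, N.+1%:R^-1 < E / 2 / (c * D + 1).
  by apply: inv_nat_lt; rewrite !divr_gt0.
have [z /(_ _ Ae) muz] := unif_approx mu y N PA.
exists N, z; apply: (@le_lt_trans _ _ (e / 2)); last first.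
  by rewrite ltr_pdivrMr// ltr_pMr// ltr1n.
apply: Wp_le; rewrite ?(ltW e20)//; apply: cost_le_trans muz.
rewrite -/c -/D -/E mulrC divfK ?gt_eqF// [leRHS]splitr lerD2l.
move: NE; rewrite ltr_pdivlMr// => NE; apply: le_trans (ltW NE).
by rewrite mulrC ler_wpM2l// lerDl.
Qed.

End uniform_dense.

(** * Wasserstein distance between uniform measures *)

Section discrete_plans.
Context {R : realType} (p : R).
Hypothesis p1 : 1 <= p.

Let p0 : 0 < p. Proof. exact: lt_le_trans p1. Qed.

(** Transport plans between the index sets of two uniform measures.  Indices
    rather than points, because the points need not be distinct, and because the
    same plan can then be used in two different spaces. *)
Definition doubly_uniform (N M : nat) (a : nat -> nat -> R) : Prop :=
  [/\ forall j l, 0 <= a j l,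
      forall j, (j < N.+1)%N -> \sum_(l < M.+1) a j l = N.+1%:R^-1 &
      forall l, (l < M.+1)%N -> \sum_(j < N.+1) a j l = M.+1%:R^-1].

Lemma plan_cost_le (Y : pointedMetricType R) N M (y y' : nat -> Y) a :
  doubly_uniform N M a ->
  cost_le p (unif N y p) (unif M y' p)
    (\sum_(j < N.+1) \sum_(l < M.+1) a j l * mdist (y j) (y' l) `^ p).
Proof.
move=> [a0 arow acol].
pose m j : {measure set nat -> \bar R} :=
  msum (fun l => mscale (NngNum (a0 j l)) (\d_l)) M.+1.
have mE j B : m j B = (\sum_(l < M.+1) a j l * (val l \in B)%:R)%:E.
  rewrite /m/= /msum -sumEFin; apply: eq_bigr => l _.
  by rewrite EFinM -[((_ \in _)%:R)%:E]diracE.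
apply: (@cost_le_mixture _ _ _ _ _ _ nat N.+1 m (fun j l => (y j, y' l))).
- by move=> j _ B _.
- move=> B mB; rewrite unifE.
  rewrite [RHS](eq_bigr (fun j : 'I_N.+1 => (N.+1%:R^-1 * (y j \in B)%:R)%:E)); last first.
    by move=> j _; rewrite diracE -EFinM.
  apply: eq_bigr => j _; rewrite mE -(arow j (ltn_ord j)) mulr_suml; congr EFin; apply: eq_bigr => l _.
- move=> B mB; rewrite unifE.
  rewrite [LHS](eq_bigr (fun j : 'I_N.+1 =>
      (\sum_(l < M.+1) a j l * (y' l \in B)%:R)%:E)) => [|j _]; last first.
    by rewrite mE; congr EFin; apply: eq_bigr => l _.
  rewrite sumEFin exchange_big/= -sumEFin; apply: eq_bigr => l _.
  by rewrite diracE -EFinM -mulr_suml acol.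
rewrite le_eqVlt; apply/orP; left; apply/eqP; rewrite -sumEFin; apply: eq_bigr => j _.
have f0 l : (0 <= (mdist (y j) (y' l) `^ p)%:E)%E by exact: powdist_ge0.
rewrite ge0_integral_measure_sum//= -sumEFin; apply: eq_bigr => l _.
by rewrite ge0_integral_mscale// integral_dirac//= diracT mul1e -EFinM.
Qed.

Lemma measure_sum_fibers d (T : measurableType d) (X : choiceType)
    (m : {measure set T -> \bar R}) (h : T -> X) (S : set T) (t : seq X) :
  measurable S -> (forall z, measurable (h @^-1` [set z])) -> uniq t ->
  (\sum_(z <- t) m (S `&` h @^-1` [set z]) = m (S `&` h @^-1` [set` t]))%E.
Proof.
move=> mS mh; elim: t => [_|z t IH /= /andP[zt ut]].
  by rewrite big_nil (_ : [set` _] = set0) ?preimage_set0 ?setI0 ?measure0//;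
    apply/seteqP; split.
rewrite big_cons IH// (_ : [set` z :: t] = [set z] `|` [set` t]); last first.
  apply/seteqP; split => x /=; rewrite in_cons; first by move=> /orP[/eqP|]; [left|right].
  by move=> [->|->]; rewrite ?eqxx ?orbT.
rewrite preimage_setU setIUr measureU//.
- exact: measurableI.
- apply: measurableI => //; have -> : [set` t] = \big[setU/set0]_(z <- t) [set z].
    by rewrite -bigcup_seq; apply/seteqP; split => [x xt|x [y yt ->]//]; exists x.
  rewrite -bigcup_seq preimage_bigcup bigcup_seq.
  by apply: bigsetU_measurable => y _.
- apply/seteqP; split => // x [[_ /= ->] [_ /=]].
  by rewrite (negbTE zt).
Qed.

Lemma sum_distinct (X : eqType) n (x : nat -> X) (G : X -> R) :
  let s := [seq x j | j <- iota 0 n] in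
  \sum_(j < n) G (x j) / (count_mem (x j) s)%:R = \sum_(z <- undup s) G z.
Proof.
move=> s; pose F z := G z / (count_mem z s)%:R.
rewrite -(big_mkord xpredT (fun j => F (x j))) /index_iota subn0.
rewrite -(big_map x xpredT F) -/s -big_undup_iterop_count/=.
rewrite [LHS]big_seq [RHS]big_seq; apply: eq_bigr => z.
rewrite mem_undup => zs; rewrite Monoid.iteropE iter_addr_0 -mulr_natr /F divfK//.
by rewrite pnatr_eq0 -lt0n -has_count has_pred1.
Qed.

End discrete_plans.

Section plans_of_couplings.
Context {R : realType} (p : R).
Hypothesis p1 : 1 <= p.
Context {X : pointedMetricType R}.

Lemma measurable_set1_borel (x : X) : measurable ([set x] : set (borel X)).
Proof. by apply: compact_borel; exact: compact_set1. Qed.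

Lemma unif_set1 N (x : nat -> X) (z : X) :
  unif N x p [set z] =
  (N.+1%:R^-1 * (count_mem z [seq x j | j <- iota 0 N.+1])%:R)%:E.
Proof.
rewrite unifE -ge0_sume_distrr// EFinM -sum1_count natr_sum big_map.
rewrite (_ : iota 0 N.+1 = index_iota 0 N.+1)// big_mkord -sumEFin [in RHS]big_mkcond/=.
by congr (_ * _)%E; apply: eq_bigr => j _; rewrite diracE; case: eqP => xz; [rewrite mem_set|rewrite memNset].
Qed.

Lemma unif_support N (x : nat -> X) (B : set (borel X)) :
  unif N x p (~` [set` [seq x j | j <- iota 0 N.+1]] `&` B) = 0%E.
Proof.
rewrite unifE big1// => j _; rewrite diracE memNset ?mule0// => -[] /=.
move=> H _; apply: H => /=; rewrite (map_f x (_ : val j \in iota 0 N.+1))//.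
by rewrite mem_iota/=.
Qed.

Section coupling_plan.
Variables (N M : nat) (x x' : nat -> X).
Variable gamma : probability (borel (X * X)) R.
Hypothesis cg : coupling (unif N x p) (unif M x' p) gamma.

Let s := [seq x j | j <- iota 0 N.+1].
Let s' := [seq x' l | l <- iota 0 M.+1].
Let first (z : X) : set (borel (X * X)) := (fst : X * X -> X) @^-1` [set z].
Let second (z : X) : set (borel (X * X)) := (snd : X * X -> X) @^-1` [set z].
Let g z z' := fine (gamma (first z `&` second z')).

Let mfirst z : measurable (first z).
Proof.
by rewrite -[X in measurable X]setTI; apply: measurable_fst_borel => //;
  exact: measurable_set1_borel.
Qed.

Let msecond z : measurable (second z).
Proof.
by rewrite -[X in measurable X]setTI; apply: measurable_snd_borel => //;
  exact: measurable_set1_borel.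
Qed.

Let gE z z' : (g z z')%:E = gamma (first z `&` second z').
Proof. by rewrite fineK// fin_num_measure//; exact: measurableI. Qed.

Let measurable_finite (t : seq X) : measurable ([set` t] : set (borel X)).
Proof. by apply: compact_borel; apply: finite_compact; exact: finite_seq. Qed.

Let setI_null (S U : set (borel (X * X))) : measurable S -> measurable U ->
  gamma (~` U) = 0%E -> gamma (S `&` U) = gamma S.
Proof.
move=> mS mU U0; rewrite -[in RHS](setIT S) -(setUv U) setIUr measureU//.
- rewrite [X in (_ + X)%E](_ : _ = 0%E) ?adde0//.
  apply/eqP; rewrite eq_le measure_ge0 andbT -[leRHS]U0.
  by apply: le_measure; rewrite ?inE//; [apply: measurableI => //; exact: measurableC|
    exact: measurableC].
- exact: measurableI.
- by apply: measurableI => //; exact: measurableC.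
- by rewrite setIACA setICr setI0.
Qed.

Let row z : \sum_(z' <- undup s') g z z' = N.+1%:R^-1 * (count_mem z s)%:R.
Proof.
apply: EFin_inj; rewrite -sumEFin -unif_set1.
under eq_bigr do rewrite gE.
rewrite (measure_sum_fibers _ (mfirst z) msecond (undup_uniq _)).
have mS := measurable_finite (undup s').
have mU : measurable ((snd : X * X -> X) @^-1` [set` undup s'] : set (borel (X * X))).
  by rewrite -[X in measurable X]setTI; exact: measurable_snd_borel.
have mSC : measurable (~` [set` undup s'] : set (borel X)) by exact: measurableC.
apply: (etrans (setI_null (mfirst _) mU _)); last first.
  exact: (coupling_setT1 cg (measurable_set1_borel z)).
apply: (etrans (coupling_setT2 cg mSC)); rewrite -[X in unif _ _ _ X]setIT.
rewrite -(unif_support M x' setT); congr (unif M x' p _); congr (~` _ `&` _).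
by apply/seteqP; split => w; rewrite /mkset mem_undup.
Qed.

Let col z' : \sum_(z <- undup s) g z z' = M.+1%:R^-1 * (count_mem z' s')%:R.
Proof.
apply: EFin_inj; rewrite -sumEFin -unif_set1.
under eq_bigr do rewrite gE setIC.
rewrite (measure_sum_fibers _ (msecond z') mfirst (undup_uniq _)).
have mS := measurable_finite (undup s).
have mU : measurable ((fst : X * X -> X) @^-1` [set` undup s] : set (borel (X * X))).
  by rewrite -[X in measurable X]setTI; exact: measurable_fst_borel.
have mSC : measurable (~` [set` undup s] : set (borel X)) by exact: measurableC.
apply: (etrans (setI_null (msecond _) mU _)); last first.
  exact: (coupling_setT2 cg (measurable_set1_borel z')).
apply: (etrans (coupling_setT1 cg mSC)); rewrite -[X in unif _ _ _ X]setIT.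
rewrite -(unif_support N x setT); congr (unif N x p _); congr (~` _ `&` _).
by apply/seteqP; split => w; rewrite /mkset mem_undup.
Qed.

Let cnt_neq0 n (y : nat -> X) j : (j < n)%N ->
  (count_mem (y j) [seq y i | i <- iota 0 n])%:R != 0 :> R.
Proof.
move=> jn; rewrite pnatr_eq0 -lt0n -has_count has_pred1.
by rewrite (map_f y (_ : j \in iota 0 n))// mem_iota.
Qed.

(** The mass that [gamma] gives to a pair of points is shared equally between
    all pairs of indices that stand for it. *)
Lemma coupling_plan : exists a, doubly_uniform N M a /\
  ((\sum_(j < N.+1) \sum_(l < M.+1) a j l * mdist (x j) (x' l) `^ p)%:E <=
    transport_cost p gamma)%E.
Proof.
exists (fun j l => g (x j) (x' l) / (count_mem (x j) s)%:R / (count_mem (x' l) s')%:R).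
split; first split.
- by move=> j l; rewrite !divr_ge0// fine_ge0.
- move=> j jN; have := sum_distinct M.+1 x' (fun z' => g (x j) z' / (count_mem (x j) s)%:R).
  rewrite /= -/s' => ->; rewrite -mulr_suml row mulfK//.
  exact: (cnt_neq0 x jN).
- move=> l lM; have := sum_distinct N.+1 x (fun z => g z (x' l) / (count_mem (x' l) s')%:R).
  rewrite /= -/s => E; under eq_bigr do rewrite mulrAC.
  by rewrite E -mulr_suml col mulfK//; exact: (cnt_neq0 x' lM).
pose F z z' := g z z' * mdist z z' `^ p.
rewrite (_ : \sum_(j < _) _ = \sum_(z <- undup s) \sum_(z' <- undup s') F z z'); last first.
  rewrite -(sum_distinct N.+1 x (fun z => \sum_(z' <- undup s') F z z')) -/s.
  apply: eq_bigr => j _.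
  rewrite -(sum_distinct M.+1 x' (fun z' => F (x j) z')) -/s' mulr_suml.
  by apply: eq_bigr => l _; rewrite /F; ring.
pose P := [seq (z, z') | z <- undup s, z' <- undup s'].
pose E (zz : X * X) := first zz.1 `&` second zz.2.
have mE zz : measurable (E zz) by exact: measurableI.
pose f (z : borel (X * X)) : \bar R := (mdist (z : X * X).1 (z : X * X).2 `^ p)%:E.
have mf B : measurable_fun B f.
  by apply: measurable_funS (@measurable_mdist2 _ X p).
have f0 z : (0 <= f z)%E by exact: powdist_ge0.
rewrite (_ : (\sum_(z <- undup s) _)%:E = (\sum_(zz <- P) \int[gamma]_(z in E zz) f z)%E).
  rewrite -ge0_integral_bigsetU//.
  - by apply: ge0_subset_integral => //; apply: bigsetU_measurable => zz _.
  - by apply: allpairs_uniq; rewrite ?undup_uniq// => -[a b] [c d].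
  - apply/trivIsetP => -[a b] [c d] _ _ /eqP abcd; apply/seteqP; split => // -[u v].
    by move=> [[/= ua vb] [/= uc vd]]; apply: abcd; rewrite -ua -vb uc vd.
rewrite big_allpairs -sumEFin; apply: eq_bigr => z _.
rewrite -sumEFin; apply: eq_bigr => z' _.
rewrite (eq_integral (fun=> (mdist z z' `^ p)%:E)).
  by rewrite integral_cst// /F EFinM gE muleC.
by move=> zz; rewrite inE => -[/= z1 z2]; rewrite /f z1 z2.
Qed.

End coupling_plan.

End plans_of_couplings.

Section unif_perturbation.
Context {R : realType} (p : R).
Hypothesis p1 : 1 <= p.

Let p0 : 0 < p. Proof. exact: lt_le_trans p1. Qed.

(** A nearly optimal coupling on [X] gives a plan between the indices, and this
    plan a coupling on [Y]; its cost is estimated with [powR_split], the added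
    constant [e] being a function of [p]-norm [e]. *)
Lemma Wp_unif_le (X Y : pointedMetricType R) N M (x x' : nat -> X) (y y' : nat -> Y) e :
  0 < e ->
  (forall j l, (j < N.+1)%N -> (l < M.+1)%N ->
    mdist (y j) (y' l) <= mdist (x j) (x' l) + e) ->
  Wp (unif N y p) (unif M y' p) <= Wp (unif N x p) (unif M x' p) + e.
Proof.
move=> e0 xy; apply/ler_addgt0Pr => d d0; set W := Wp (unif N x p) _.
have W0 : 0 <= W by exact: Wp_ge0.
have c0 : 0 < W + d by rewrite ltr_wpDl.
have [|g cg gc] := Wp_cost_le p1 (mu := unif N x p) (nu := unif M x' p) (c := W + d).
  by rewrite ltrDl.
have [a [da ac]] := coupling_plan cg.
have := le_trans ac gc; rewrite lee_fin => {}ac.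
apply: Wp_le => //; first by rewrite addrAC addr_ge0// ltW.
apply: cost_le_trans (plan_cost_le p y y' da).
have [a0 arow _] := da.
rewrite addrAC -(powR_splitE p1 c0 e0).
set C1 := (_ / _) `^ _; set C2 := (_ / _) `^ _.
have C10 : 0 <= C1 by exact: powR_ge0.
have C20 : 0 <= C2 by exact: powR_ge0.
apply: (@le_trans _ _ (\sum_(j < N.+1) \sum_(l < M.+1)
    (C1 * (a j l * mdist (x j) (x' l) `^ p) + C2 * e `^ p * a j l))).
  apply: ler_sum => j _; apply: ler_sum => l _.
  rewrite [leRHS](_ : _ = a j l * (C1 * mdist (x j) (x' l) `^ p + C2 * e `^ p)); last by ring.
  apply: ler_wpM2l => //.
  apply: le_trans (powR_split p1 c0 e0 (mdist_ge0 _ _) (ltW e0)).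
  by apply: ge0_ler_powR; rewrite ?nnegrE ?(ltW p0) ?addr_ge0 ?mdist_ge0 ?(ltW e0)// xy.
under eq_bigr do rewrite big_split/= -!mulr_sumr arow//.
rewrite big_split/= -mulr_sumr; apply: lerD; first exact: ler_wpM2l.
by rewrite sumr_const card_ord -(mulr_natr (_ / _)) mulfVK ?pnatr_eq0.
Qed.

End unif_perturbation.

(** * Countable saturation and metric ultralimits *)

Section ultrafilter.
Variable omega : free_ultrafilter.

(** The ultrafilter is free, so it contains the complement of each point. *)
Lemma ultra_ge (k : nat) : ultra_sets omega [set i | (k <= i)%N].
Proof.
elim: k => [|k IH]; first by apply: filterS filterT.
have nk : ultra_sets omega (~` [set k]).
  by have [/ultra_free|//] := in_ultra_setVsetC [set k] (ultra_setsP omega).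
apply: filterS (filterI IH nk) => i [/= ki ik].
by rewrite ltn_neqAle ki andbT; apply/eqP => ki'; apply: ik; rewrite ki'.
Qed.

Lemma ultra_forall_lt (n : nat) (A : nat -> set nat) :
  (forall j, (j < n)%N -> ultra_sets omega (A j)) ->
  ultra_sets omega [set i | forall j, (j < n)%N -> A j i].
Proof.
elim: n => [|n IH] An; first by apply: filterS filterT.
apply: filterS (filterI (IH (fun j jn => An j (ltnW jn))) (An n (leqnn _))).
by move=> i [/= Ai Ani] j; rewrite ltnS leq_eqVlt => /orP[/eqP ->|/Ai].
Qed.

Lemma ultra_exists_lt (n : nat) (A : nat -> set nat) :
  ultra_sets omega [set i | exists2 j, (j < n)%N & A j i] ->
  exists2 j, (j < n)%N & ultra_sets omega (A j).
Proof.
move=> An; apply: contrapT => nA.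
have : ultra_sets omega [set i | forall j, (j < n)%N -> (~` A j) i].
  apply: ultra_forall_lt => j jn.
  have [Aj|//] := in_ultra_setVsetC (A j) (ultra_setsP omega).
  by exfalso; apply: nA; exists j.
move=> /(filterI An) E; apply: (@filter_not_empty _ (ultra_sets omega)).
by apply: filterS E => i [[j jn Aji] /(_ j jn)].
Qed.

(** Countable saturation: [f i] is the largest [n <= i] such that [i] belongs to
    [A j] for all [j < n]. *)
Lemma ultra_diagonal (A : nat -> set nat) : (forall n, ultra_sets omega (A n)) ->
  exists f : nat -> nat, (forall i j, (j < f i)%N -> A j i) /\
    forall k, ultra_sets omega [set i | (k <= f i)%N].
Proof.
move=> oA.
pose P i n := (n <= i)%N && `[< forall j, (j < n)%N -> A j i >].
have P0 i : exists n, P i n by exists 0%N; rewrite /P/=; apply/asboolP.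
have Pi i n : P i n -> (n <= i)%N by case/andP.
exists (fun i => ex_maxn (P0 i) (Pi i)); split.
  by move=> i j; case: ex_maxnP => n /andP[_ /asboolP Pn] _; exact: Pn.
move=> k; apply: filterS (filterI (ultra_ge k) (ultra_forall_lt (fun j _ => oA j))).
by move=> i [/= ki Ai]; case: ex_maxnP => n _ nP; apply: nP; rewrite /P ki/=; apply/asboolP; exact: Ai.
Qed.

End ultrafilter.

Section pseudometric_ultralimit.
Context {R : realType} (omega : free_ultrafilter).
Context {T : nat -> Type} (d : forall i, T i -> T i -> R) (e : forall i, T i).
Hypothesis d_ge0 : forall i (x y : T i), 0 <= d x y.
Hypothesis dxx : forall i (x : T i), d x x = 0.
Hypothesis dC : forall i (x y : T i), d x y = d y x.
Hypothesis d_triangle : forall i (x y z : T i), d x z <= d x y + d y z.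

Local Notation ulimT := (ulim omega d e).
Local Notation "x `_# i" := (urepr (sval x) i) (at level 10).
Local Notation dist := (@ultralimit_dist R omega T d e).

Lemma in_limP (u : forall i, T i) :
  in_lim d e (uclass omega u) <-> exists r, ultra_sets omega [set i | d (e i) (u i) <= r].
Proof.
have de := urepr_class omega e; have du := urepr_class omega u.
split=> [/hfinite_class[r]|[r ur]].
  move=> /(filterI (filterI de du)) H; exists r; apply: filterS H.
  by move=> i [[/= -> ->]]; rewrite ger0_norm.
apply/hfinite_class; exists r; apply: filterS (filterI (filterI de du) ur).
by move=> i [[/= -> ->]]; rewrite ger0_norm.
Qed.

Let lim_bounded (x : ulimT) : exists r, ultra_sets omega [set i | d (e i) (x`_#i) <= r].
Proof. by apply/in_limP; rewrite ureprK; exact: (proj2_sig x). Qed.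

Let hcvg (x y : ulimT) : d (x`_#i) (y`_#i) @[i --> ultra_sets omega] -->
  hst (udist d (sval x) (sval y)).
Proof.
apply: hst_class_cvg; apply/hfinite_class.
have [r xr] := lim_bounded x; have [s ys] := lim_bounded y.
exists (r + s); apply: filterS (filterI xr ys) => i [/= xri ysi].
rewrite ger0_norm//; apply: le_trans (d_triangle _ (e i) _) _.
by rewrite dC lerD.
Qed.

Let H (x y : ulimT) : R := hst (udist d (sval x) (sval y)).

Let H_triangle (x y z : ulimT) : H x z <= H x y + H y z.
Proof.
have xyz : d (x`_#i) (y`_#i) + d (y`_#i) (z`_#i) @[i --> ultra_sets omega] -->
    H x y + H y z by apply: cvgD; exact: hcvg.
refine (ultra_le_cvg (@hcvg x z) xyz _); apply: filterS filterT => i _; exact: d_triangle.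
Qed.

Let HC (x y : ulimT) : H x y = H y x.
Proof. by congr (hst (uclass _ _)); apply/funext => i; rewrite dC. Qed.

Let H_ge0 (x y : ulimT) : 0 <= H x y.
Proof.
by apply: (ultra_le_cvg (cvg_cst 0) (@hcvg x y)); apply: filterS filterT => i _ /=.
Qed.

Let nearE (x y : ulimT) : ulim_near x y <-> H x y = 0.
Proof.
split=> [/hclose_cvg /hst_cvg//|xy0]; apply/hclose_cvg; rewrite -xy0; exact: hcvg.
Qed.

Let Hxx (x : ulimT) : H x x = 0.
Proof.
apply: hst_cvg; rewrite (_ : (fun _ => _) = fun=> 0); first exact: cvg_cst.
by apply/funext => i; rewrite dxx.
Qed.

(** The triangle inequality makes [ulim_near] transitive, so that its classes are
    those of an equivalence relation. *)
Lemma ulim_st_near (x y : ulimT) : ulim_st x = ulim_st y <-> ulim_near x y.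
Proof.
apply: qclassP => [u|u v|v u w].
- exact/nearE.
- by move=> /nearE uv; apply/nearE; rewrite HC.
- move=> /nearE uv /nearE vw; apply/nearE/eqP; rewrite eq_le H_ge0 andbT.
  by rewrite (le_trans (H_triangle _ v _))// uv vw addr0.
Qed.

Lemma ultralimit_distE (x y : ulimT) : dist (ulim_st x) (ulim_st y) = H x y.
Proof.
have qx z : H z (qrepr (ulim_st z)) = 0.
  by apply/nearE/ulim_st_near; rewrite [RHS]qreprK.
have le u v u' v' : H u u' = 0 -> H v' v = 0 -> H u v <= H u' v'.
  move=> uu vv; apply: le_trans (H_triangle u u' v) _.
  by rewrite uu add0r (le_trans (H_triangle u' v' v))// vv addr0.
apply/eqP; rewrite eq_le; apply/andP; split; last by apply: le; rewrite ?qx// HC qx.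
by apply: le; rewrite ?qx// HC qx.
Qed.

Lemma ultralimit_dist_cvg (x y : ulimT) :
  d (x`_#i) (y`_#i) @[i --> ultra_sets omega] --> dist (ulim_st x) (ulim_st y).
Proof. by rewrite ultralimit_distE; exact: hcvg. Qed.

Lemma ultralimit_dist_near (x y : ulimT) eps : 0 < eps ->
  ultra_sets omega [set i | `|d (x`_#i) (y`_#i) - dist (ulim_st x) (ulim_st y)| < eps].
Proof.
move=> eps0; have /cvgrPdistC_lt := @ultralimit_dist_cvg x y.
exact.
Qed.

Lemma ultralimit_dist_le (x y : ulimT) c :
  ultra_sets omega [set i | d (x`_#i) (y`_#i) <= c] ->
  dist (ulim_st x) (ulim_st y) <= c.
Proof. exact: ultra_le_cvg (@ultralimit_dist_cvg x y) (cvg_cst c). Qed.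

Lemma ultralimit_dist_lt (x y : ulimT) c :
  dist (ulim_st x) (ulim_st y) < c ->
  ultra_sets omega [set i | d (x`_#i) (y`_#i) < c].
Proof.
move=> xyc; have e0 : 0 < c - dist (ulim_st x) (ulim_st y) by rewrite subr_gt0.
apply: filterS (ultralimit_dist_near x y e0) => i /=.
by rewrite ltr_norml => /andP[_]; rewrite ltrBlDr subrK.
Qed.

Lemma ulim_st_eq0 (x y : ulimT) :
  dist (ulim_st x) (ulim_st y) = 0 -> ulim_st x = ulim_st y.
Proof. by rewrite ultralimit_distE => /nearE/ulim_st_near. Qed.

Lemma ultralimit_dist_triangle (x y z : ulimT) : dist (ulim_st x) (ulim_st z) <=
  dist (ulim_st x) (ulim_st y) + dist (ulim_st y) (ulim_st z).
Proof. by rewrite !ultralimit_distE. Qed.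

Lemma ultralimit_dist_ge0 (x y : ulimT) : 0 <= dist (ulim_st x) (ulim_st y).
Proof. by rewrite ultralimit_distE. Qed.

(** The space of all classes is complete: the internal sequence that follows
    [v n] on the indices at which the first [n] terms have nearly their limiting
    mutual distances is a limit of the sequence [v]. *)
Lemma cauchy_diagonal (v : nat -> forall i, T i) (D : nat -> nat -> R) (delta : nat -> R) :
  (forall k l eps, 0 < eps ->
    ultra_sets omega [set i | d (v k i) (v l i) <= D k l + eps]) ->
  (forall k l, (k <= l)%N -> D k l <= delta k) ->
  exists f : nat -> nat, forall k, ultra_sets omega
    [set i | d (v k i) (v (f i) i) <= delta k + k.+1%:R^-1].
Proof.
move=> vD Dd.
pose A n := [set i | forall k, (k < n.+1)%N -> d (v k i) (v n i) <= D k n + n.+1%:R^-1].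
have [n|f [fA fk]] := @ultra_diagonal omega A.
  by apply: ultra_forall_lt => k _; apply: vD; rewrite invr_gt0.
(* The index is only constrained by [A j] for j < f i, hence the predecessor. *)
exists (fun i => (f i).-1) => k; apply: filterS (fk k.+1) => i /= ki.
have f0 : (0 < f i)%N by exact: leq_ltn_trans ki.
have kf : (k <= (f i).-1)%N by rewrite -ltnS prednK.
have fi : ((f i).-1 < f i)%N by rewrite ltn_predL.
have fik : (k < (f i).-1.+1)%N by rewrite ltnS.
apply: le_trans (fA _ _ fi _ fik) _; apply: lerD; first exact: Dd.
by rewrite lef_pV2 ?posrE// ler_nat.
Qed.

End pseudometric_ultralimit.

(** * Liftings *)

Lemma third_lt {R : realType} (q e : R) : q < e / 3 -> q + q + q < e.
Proof. lra. Qed.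

Section iota_construction.
Context {R : realType} (omega : free_ultrafilter) (X : nat -> pointedMetricType R) (p : R).
Hypothesis p1 : 1 <= p.

Local Notation hatX := (hat omega X).
Local Notation limX := (uspace_lim omega X).
Local Notation limP := (Pp_lim omega X p).
Local Notation "x `_# i" := (urepr (sval x) i) (at level 10).

Let W i (mu nu : Pp (X i) p) : R := Wp mu nu.
Let W0 i (mu nu : Pp (X i) p) : 0 <= W mu nu. Proof. exact: Wp_ge0. Qed.
Let Wxx i (mu : Pp (X i) p) : W mu mu = 0. Proof. exact: Wpxx. Qed.
Let WC i (mu nu : Pp (X i) p) : W mu nu = W nu mu. Proof. exact: WpC. Qed.
Let Wtri i (mu nu rho : Pp (X i) p) : W mu rho <= W mu nu + W nu rho.
Proof. exact: Wp_triangle. Qed.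

Lemma hat_dist_near (x y : limX) eps : 0 < eps ->
  ultra_sets omega [set i |
    `|mdist (x`_#i) (y`_#i) - mdist (st_hat x) (st_hat y)| < eps].
Proof.
apply: ultralimit_dist_near => *; [exact: mdist_ge0|exact: mdistxx|exact: mdistC|].
exact: mdist_triangle.
Qed.

Definition unif_at N (x : nat -> limX) i : Pp (X i) p := unif N (fun j => x j`_#i) p.
Definition unif_hat N (x : nat -> limX) : Pp hatX p := unif N (fun j => st_hat (x j)) p.

(** The distances between finitely many points of the ultralimit are the limits
    of the distances between their representatives, so [Wp_unif_le] applies in
    both directions. *)
Lemma unif_near N M (x y : nat -> limX) eps : 0 < eps ->
  ultra_sets omega [set i |
    `|Wp (unif_at N x i) (unif_at M y i) - Wp (unif_hat N x) (unif_hat M y)| <= eps].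
Proof.
move=> eps0.
pose B j l := [set i | `|mdist (x j`_#i) (y l`_#i) -
  mdist (st_hat (x j)) (st_hat (y l))| < eps].
have : ultra_sets omega [set i | forall j, (j < N.+1)%N ->
    [set i | forall l, (l < M.+1)%N -> B j l i] i].
  apply: ultra_forall_lt => j _; apply: ultra_forall_lt => l _.
  exact: hat_dist_near.
apply: filterS => i Bi /=; rewrite ler_norml lerBlDl lerBrDl; apply/andP; split.
  rewrite -lerBrDr opprK; apply: Wp_unif_le => // j l jN lM.
  by have := Bi j jN l lM; rewrite /B/= ltr_norml => /andP[+ _];
    rewrite ltrBrDl => /ltW; rewrite lerBlDr.
apply: Wp_unif_le => // j l jN lM.
by have := Bi j jN l lM; rewrite /B/= ltr_norml => /andP[_]; rewrite ltrBlDl => /ltW.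
Qed.

(** This relation is the extension by density in the construction of [iota]: it
    determines [st_Wp m] from [mu], without mentioning [iota]. *)
Definition approximates (mu : Pp hatX p) (m : limP) : Prop :=
  forall eps, 0 < eps -> exists N (x : nat -> limX),
    Wp mu (unif_hat N x) < eps /\
    ultra_sets omega [set i | Wp (m`_#i) (unif_at N x i) < eps].

Lemma approximates_dist mu nu m n : approximates mu m -> approximates nu n ->
  Wp_hat (st_Wp m) (st_Wp n) = Wp mu nu.
Proof.
move=> am an; apply/eqP; rewrite -subr_eq0 -normr_le0; apply/ler_addgt0Pr => e e0.
rewrite add0r; have e6 : 0 < e / 6 by rewrite divr_gt0.
have [N [x [mux mx]]] := am _ e6; have [M [y [nuy ny]]] := an _ e6.
have mn := ultralimit_dist_near W0 Wxx WC Wtri m n e6.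
have xy := unif_near N M x y e6.
have [i [[/= mxi nyi] [mni xyi]]] := filter_ex (filterI (filterI mx ny) (filterI mn xy)).
have H1 := Wp_triangle p1 (m`_#i) (unif_at N x i) (n`_#i).
have H2 := Wp_triangle p1 (unif_at N x i) (unif_at M y i) (n`_#i).
have H3 := Wp_triangle p1 (unif_at N x i) (m`_#i) (unif_at M y i).
have H4 := Wp_triangle p1 (m`_#i) (n`_#i) (unif_at M y i).
have H5 := Wp_triangle p1 mu (unif_hat N x) nu.
have H6 := Wp_triangle p1 (unif_hat N x) (unif_hat M y) nu.
have H7 := Wp_triangle p1 (unif_hat N x) mu (unif_hat M y).
have H8 := Wp_triangle p1 mu nu (unif_hat M y).
rewrite (WpC p1 (unif_at M y i)) in H2; rewrite (WpC p1 (unif_at N x i) (m`_#i)) in H3.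
rewrite (WpC p1 (unif_hat M y) nu) in H6; rewrite (WpC p1 (unif_hat N x) mu) in H7.
move: mni xyi; rewrite /W !ltr_norml !ler_norml => /andP[A1 A2] /andP[A3 A4].
rewrite /Wp_hat /st_Wp.
move: A1 A2; set D := ultralimit_dist _ _ => A1 A2.
by apply/andP; split; lra.
Qed.

Let delta_e i : Pp (X i) p := unif 0 (fun=> point) p.

Lemma unif_at_in_lim N x : in_lim W delta_e (uclass omega (unif_at N x)).
Proof.
apply/(in_limP omega delta_e W0).
have de : ultra_sets omega [set i | (base_lim omega X)`_#i = point].
  exact: urepr_class.
pose b : nat -> limX := fun=> base_lim omega X.
exists (Wp (unif_hat 0 b) (unif_hat N x) + 1).
apply: filterS (filterI de (unif_near 0 N b x ltr01)) => i [/= bi].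
rewrite ler_norml lerBlDl => /andP[_]; apply: le_trans.
by rewrite /W /delta_e /unif_at /b bi.
Qed.

(** Choose uniform measures that converge to [mu], lift their points, and take
    a diagonal sequence of the internal uniform measures so obtained. *)
Lemma approximates_exists mu : exists2 m, approximates mu m & hyperfinite (sval m).
Proof.
have /choice[Nz muz] : forall k : nat, exists Nz : nat * (nat -> hatX),
    Wp mu (unif Nz.1 Nz.2 p) < k.+1%:R^-1.
  move=> k; have [|N [z muz]] := unif_dense p1 mu (e := k.+1%:R^-1).
    by rewrite invr_gt0.
  by exists (N, z).
pose N k := (Nz k).1; pose x k j : limX := qrepr ((Nz k).2 j).
have mux k : Wp mu (unif_hat (N k) (x k)) < k.+1%:R^-1.
  have := muz k; rewrite /unif_hat (_ : (fun j => st_hat (x k j)) = (Nz k).2)//.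
  by apply/funext => j; exact: qreprK.
pose v k i := unif_at (N k) (x k) i.
pose D k l := Wp (unif_hat (N k) (x k)) (unif_hat (N l) (x l)).
pose delta k : R := k.+1%:R^-1 + k.+1%:R^-1.
have vD k l eps : 0 < eps -> ultra_sets omega [set i | W (v k i) (v l i) <= D k l + eps].
  move=> eps0; apply: filterS (unif_near (N k) (N l) (x k) (x l) eps0) => i /=.
  by rewrite ler_norml lerBlDl => /andP[_].
have Dd k l : (k <= l)%N -> D k l <= delta k.
  move=> kl; apply: le_trans (Wp_triangle p1 _ mu _) _.
  rewrite WpC//; apply: lerD; first exact: ltW.
  by apply: le_trans (ltW (mux l)) _; rewrite lef_pV2 ?posrE// ler_nat.
have [f vf] := cauchy_diagonal vD Dd.
pose m i := v (f i) i.
have mlim : in_lim W delta_e (uclass omega m).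
  have /(in_limP omega delta_e W0)[r vr] := unif_at_in_lim (N 0%N) (x 0%N).
  apply/(in_limP omega delta_e W0); exists (r + (delta 0%N + 0.+1%:R^-1)).
  apply: filterS (filterI vr (vf 0%N)) => i [/= vri vfi].
  by apply: le_trans (Wtri _ (v 0%N i) _) _; exact: lerD.
exists (exist _ (uclass omega m) mlim).
  move=> e e0; have [k ke] : exists k : nat, k.+1%:R^-1 < e / 3.
    by apply: inv_nat_lt; rewrite divr_gt0.
  exists (N k), (x k); split.
    by apply: lt_trans (mux k) (lt_trans ke _); rewrite ltr_pdivrMr// ltr_pMr// ltr1n.
  apply: filterS (filterI (urepr_class omega m) (vf k)) => i [/= -> vfi].
  by rewrite WpC//; apply: le_lt_trans vfi (third_lt ke).
exists m => // i; exists (N (f i)).+1, (fun=> (N (f i)).+1%:R^-1), (fun j => x (f i) j`_#i).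
split; first by move=> j; rewrite invr_ge0.
by move=> A mA; rewrite /m /v /unif_at unifE.
Qed.

Lemma st_Wp_eq (m n : limP) : Wp_hat (st_Wp m) (st_Wp n) = 0 -> st_Wp m = st_Wp n.
Proof. exact: (ulim_st_eq0 W0 Wxx WC Wtri). Qed.

(** [iota] is a choice among the functions that satisfy [is_iota], so its
    properties depend on the existence of such a function. *)
Lemma is_iota_exists : exists f : Pp hatX p -> Pp_hat omega X p, is_iota f.
Proof.
have /choice[m mP] mu : exists m, approximates mu m.
  by have [m am _] := approximates_exists mu; exists m.
exists (fun mu => st_Wp (m mu)); split=> [mu nu|N x xhat xx].
  exact: approximates_dist.
pose u i : Pp (X i) p := unif N (fun j => x j i) p.
have uE : ultra_sets omega [set i | W (unif_at N xhat i) (u i) <= 0].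
  have : ultra_sets omega [set i | forall j, (j < N.+1)%N -> xhat j`_#i = x j i].
    apply: (ultra_forall_lt (A := fun j => [set i | xhat j`_#i = x j i])) => j _.
    by rewrite xx; exact: urepr_class.
  apply: filterS => i xi /=; apply/ler_addgt0Pr => e e0; rewrite add0r.
  have -> : e = Wp (unif_at N xhat i) (unif_at N xhat i) + e by rewrite Wpxx// add0r.
  by apply: Wp_unif_le => // j l jN lN; rewrite -(xi l lN) lerDl ltW.
have ulim : in_lim W delta_e (uclass omega u).
  have /(in_limP omega delta_e W0)[r ur] := unif_at_in_lim N xhat.
  apply/(in_limP omega delta_e W0); exists (r + 0).
  apply: filterS (filterI ur uE) => i [/= uri uEi].
  by apply: le_trans (Wtri _ (unif_at N xhat i) _) _; exact: lerD.
pose ml : limP := exist _ (uclass omega u) ulim.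
have aml : approximates (unif_hat N xhat) ml.
  move=> e e0; exists N, xhat; split; first by rewrite Wpxx.
  apply: filterS (filterI (urepr_class omega u) uE) => i [/= -> uEi].
  by rewrite WpC//; exact: le_lt_trans uEi e0.
exists ml; first by [].
exact: st_Wp_eq (etrans (approximates_dist (mP (unif_hat N xhat)) aml) (Wpxx p1 _)).
Qed.

(** Both sides are within any [e] of the class of one internal uniform
    measure, which is the value of [f] at a uniform measure close to [mu]. *)
Lemma is_iota_unique f mu m : is_iota f -> approximates mu m -> f mu = st_Wp m.
Proof.
move=> [fW funif] am; pose q : limP := qrepr (f mu).
have qE : st_Wp q = f mu by exact: qreprK.
rewrite -qE; apply: st_Wp_eq; apply/eqP; rewrite eq_le; apply/andP; split; last first.
  exact: (ultralimit_dist_ge0 W0 Wxx WC Wtri).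
apply/ler_addgt0Pr => e e0; rewrite add0r; have e2 : 0 < e / 2 by rewrite divr_gt0.
have [N [x [mux mx]]] := am _ e2.
have [|m' m'E fm'] := funif N (fun j i => x j`_#i) x.
  by move=> j; rewrite ureprK.
have fmu : Wp_hat (st_Wp q) (st_Wp m') <= e / 2 by rewrite qE -fm' fW; exact: ltW.
have m'm : Wp_hat (st_Wp m') (st_Wp m) <= e / 2.
  apply: (ultralimit_dist_le W0 Wxx WC Wtri).
  have m'r : ultra_sets omega [set i | m'`_#i = unif_at N x i].
    by rewrite m'E; exact: urepr_class.
  by apply: filterS (filterI m'r mx) => i [/= -> mxi]; rewrite WC ltW.
have tri : Wp_hat (st_Wp q) (st_Wp m) <=
    Wp_hat (st_Wp q) (st_Wp m') + Wp_hat (st_Wp m') (st_Wp m).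
  exact: (ultralimit_dist_triangle W0 Wxx WC Wtri).
by apply: (le_trans tri (le_trans (lerD fmu m'm) _)); rewrite -splitr.
Qed.

Lemma approximates_lifting mu m : approximates mu m -> lifting mu m.
Proof.
move=> am; apply/esym/is_iota_unique => //; have [f fi] := is_iota_exists.
exact: (@xgetPex _ _ (@is_iota R omega X p) (ex_intro _ f fi)).
Qed.

End iota_construction.

(** * Loeb measures *)

Section loeb_sigma_additive.
Context {R : realType} (omega : free_ultrafilter) (X : nat -> pointedMetricType R).
Variable mu : forall i, probability (borel (X i)) R.

Local Notation int := (@internal R omega X).

(** If no finite number of the [F k] covers [B], then a diagonal choice of points
    outside of the first [f i] of them gives an element of [internal B] that lies
    in none of the [internal (F k)]. *)
Lemma internal_compact (B : forall i, set (X i)) (F : nat -> forall i, set (X i)) :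
  int B `<=` \bigcup_k int (F k) ->
  exists n, int B `<=` \bigcup_(k < n) int (F k).
Proof.
move=> BF; apply: contrapT => nBF.
pose A n := [set i | exists z, B i z /\ forall k, (k < n)%N -> ~ F k i z].
have [n|f [fA fk]] := @ultra_diagonal omega A.
  have [//|nAn] := in_ultra_setVsetC (A n) (ultra_setsP omega).
  exfalso; apply: nBF; exists n => x /internal_urepr Bx.
  have [|k kn kx] := @ultra_exists_lt omega n (fun k => [set i | F k i (urepr x i)]).
    apply: filterS (filterI nAn Bx) => i [/= nAi Bi]; apply: contrapT => nF.
    apply: nAi; exists (urepr x i); split => // k kn Fk.
    by apply: nF; exists k.
  by exists k => //; apply/internal_urepr.
(* Almost surely f i > 0, and then a point with the required properties exists. *)
pose z i : X i := xget point [set z | B i z /\ forall k, (k < (f i).-1)%N -> ~ F k i z].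
have zP i : (0 < f i)%N -> B i (z i) /\ forall k, (k < (f i).-1)%N -> ~ F k i (z i).
  move=> fi; have [|w wP] := fA i (f i).-1; first by rewrite ltn_predL.
  exact: (@xgetPex _ _ [set z | B i z /\ forall k, (k < (f i).-1)%N -> ~ F k i z]
    (ex_intro _ w wP)).
have [|k _ [y Fky yz]] := BF (uclass omega z).
  by exists z => //; apply: filterS (fk 1%N) => i /zP[].
have : ultra_sets omega [set i | y i = z i] by apply/uclassP.
move=> yz'; apply: (@filter_not_empty _ (ultra_sets omega)).
apply: filterS (filterI (filterI Fky yz') (fk k.+2)) => i [[/= Fi yzi] ki].
have [|_ /(_ k)] := zP i; first exact: leq_ltn_trans ki.
by rewrite -yzi; apply => //; rewrite -ltnS prednK//; exact: leq_ltn_trans ki.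
Qed.

Let loeb_sigma_additive : semi_sigma_additive (@loeb_premeasure R omega X mu).
Proof.
move=> F mF tF mU.
have /choice[B BP] : forall k, exists B : forall i, set (X i),
    (forall i, measurable (B i : set (borel (X i)))) /\ F k = int B.
  by move=> k; have [B mB FB] := mF k; exists B.
have [C mC UC] := mU.
have [n UFn] : exists n, \bigcup_k F k `<=` \bigcup_(k < n) F k.
  have [|n] := @internal_compact C B.
    by rewrite -UC => x [k _ Fx]; exists k => //; rewrite -(BP k).2.
  rewrite -UC => UFn; exists n => x /UFn[k kn Bx]; exists k => //.
  by rewrite (BP k).2.
have UE N : (n <= N)%N -> \big[setU/set0]_(k < N) F k = \bigcup_k F k.
  move=> nN; rewrite -bigcup_mkord; apply/seteqP; split => x [k kn Fx]; first by exists k.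
  have [|l ln Fl] := UFn x; first by exists k.
  by exists l => //=; exact: leq_trans ln nN.
apply: cvg_near_cst; exists n => // N /= nN; rewrite -(UE N nN) big_mkord.
rewrite measure_bigsetU_ord//.
by apply/trivIsetP => i j _ _ ij; move/trivIsetP : tF; apply.
Qed.

HB.instance Definition _ := Content_isMeasure.Build _ _ _ (@loeb_premeasure R omega X mu)
  loeb_sigma_additive.

End loeb_sigma_additive.

(** * Internal sets inside the preimage of a compact set *)

Section wasserstein_enlargement.
Context {R : realType} {X : pointedMetricType R} (p : R).
Hypothesis p1 : 1 <= p.

(** Under a coupling of cost [c `^ p], the mass of [A] stays in [B] except where
    the coupling moves points by at least [r]; Markov's inequality bounds the
    measure of that event. *)
Lemma Wp_enlargement (mu nu : Pp X p) (c r : R) (A B : set (borel X)) :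
  Wp mu nu < c -> 0 < r -> measurable A -> measurable B ->
  (forall a b, A a -> mdist (a : X) b < r -> B b) ->
  (mu A <= nu B + (c `^ p / r `^ p)%:E)%E.
Proof.
move=> /(Wp_cost_le p1)[g cg gc] r0 mA mB AB.
have p0 : 0 < p by exact: lt_le_trans p1.
pose f (z : borel (X * X)) : \bar R := (mdist (z : X * X).1 (z : X * X).2 `^ p)%:E.
have mf B' : measurable_fun B' f by apply: measurable_funS (@measurable_mdist2 _ X p).
have f0 z : (0 <= f z)%E by exact: powdist_ge0.
have rp0 : 0 < r `^ p by exact: powR_gt0.
pose E : set (borel (X * X)) := f @^-1` `[(r `^ p)%:E, +oo[%classic.
have mE : measurable E by rewrite -[E]setTI; apply: mf => //; exact: emeasurable_itv.
have gE : (g E <= (c `^ p / r `^ p)%:E)%E.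
  rewrite EFinM lee_pdivlMr// muleC -integral_cst//.
  apply: le_trans gc; apply: (@le_trans _ _ (\int[g]_(z in E) f z)%E).
    apply: ge0_le_integral => //.
      by move=> z _; rewrite lee_fin ltW.
    by move=> z; rewrite /E/= in_itv/= => /andP[].
  by apply: ge0_subset_integral => //.
have mfst : measurable ((fst : X * X -> X) @^-1` A : set (borel (X * X))).
  by rewrite -[X in measurable X]setTI; exact: measurable_fst_borel.
have msnd : measurable ((snd : X * X -> X) @^-1` B : set (borel (X * X))).
  by rewrite -[X in measurable X]setTI; exact: measurable_snd_borel.
rewrite -(coupling_setT1 cg mA) -(coupling_setT2 cg mB).
apply: (@le_trans _ _ (g ((snd : X * X -> X) @^-1` B `|` E))).
  apply: le_measure; rewrite ?inE//; first exact: measurableU.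
  move=> [x y] /= Ax; have [xy|xy] := ltP (mdist x y) r.
    by left; exact: AB Ax xy.
  right; rewrite /E/= in_itv/= andbT lee_fin.
  by apply: ge0_ler_powR; rewrite ?nnegrE ?(ltW p0) ?mdist_ge0 ?(ltW r0).
by apply: le_trans (measureU2 _ _ _) _ => //; exact: leeD2l.
Qed.

End wasserstein_enlargement.

Section loeb_compact.
Context {R : realType} (omega : free_ultrafilter) (X : nat -> pointedMetricType R) (p : R).
Hypothesis p1 : 1 <= p.

Local Notation hatX := (hat omega X).
Local Notation limX := (uspace_lim omega X).
Local Notation "x `_# i" := (urepr (sval x) i) (at level 10).

Variables (mu : Pp hatX p) (m : Pp_lim omega X p).
Hypothesis am : approximates mu m.

Section net.
Variables (K : set hatX) (cK : compact K) (s : nat -> seq hatX).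
Hypothesis sK : forall k x, x \in s k -> K x.
Hypothesis netK : forall k y, K y -> exists2 x, x \in s k & mball x k.+1%:R^-1 y.

Let y k j : limX := qrepr (nth point (s k) j).

Let st_y k j : st_hat (y k j) = nth point (s k) j.
Proof. exact: qreprK. Qed.

(** The points that are close to the nets [s 0], ..., [s n] simultaneously, at
    scales proportional to their mesh; [near_hat] is the same set in the
    ultralimit. *)
Let near_at n t i : set (X i) := \bigcap_(k in `I_n.+1)
  \bigcup_(j in `I_(size (s k))) mball (y k j`_#i) (t * k.+1%:R^-1).

Let near_hat n t : set hatX := \bigcap_(k in `I_n.+1)
  \bigcup_(j in `I_(size (s k))) mball (st_hat (y k j)) (t * k.+1%:R^-1).

Let mnear_at n t i : measurable (@near_at n t i : set (borel (X i))).
Proof.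
apply: bigcap_measurable => [|k _]; first by exists 0%N.
by apply: bigcup_measurable => j _; exact: measurable_mball.
Qed.

Let mnear_hat n t : measurable (near_hat n t : set (borel hatX)).
Proof.
apply: bigcap_measurable => [|k _]; first by exists 0%N.
by apply: bigcup_measurable => j _; exact: measurable_mball.
Qed.

Let enlarge (a b t q : R) k n : (k < n.+1)%N -> a < t * k.+1%:R^-1 -> q < n.+1%:R^-1 ->
  b <= a + q -> b < (t + 1) * k.+1%:R^-1.
Proof.
move=> kn ak qn bq; apply: le_lt_trans bq _; rewrite mulrDl mul1r; apply: ltrD => //.
by apply: lt_le_trans qn _; rewrite lef_pV2 ?posrE// ler_nat.
Qed.

Let near_hatS n t a b : near_hat n t a -> mdist a b < n.+1%:R^-1 -> near_hat n (t + 1) b.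
Proof.
move=> na ab k kn; have [j js ja] := na k kn; exists j => //.
exact: enlarge kn ja ab (mdist_triangle _ _ _).
Qed.

Let near_atS n t i (a b : X i) : near_at n t a -> mdist a b < n.+1%:R^-1 ->
  near_at n (t + 1) b.
Proof.
move=> na ab k kn; have [j js ja] := na k kn; exists j => //.
exact: enlarge kn ja ab (mdist_triangle _ _ _).
Qed.

Let K_near n : K `<=` near_hat n 1.
Proof.
move=> z Kz k kn; have [x xs xz] := netK k Kz; exists (index x (s k)).
  by rewrite /= index_mem.
by rewrite st_y nth_index// mul1r.
Qed.

(** Strict inequalities between distances in the ultralimit hold between the
    distances of representatives. *)
Let near_transfer n t (x : limX) : near_hat n t (st_hat x) ->
  ultra_sets omega [set i | near_at n t (x`_#i)].
Proof.
move=> nx.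
have : ultra_sets omega [set i | forall k, (k < n.+1)%N ->
    [set i | (\bigcup_(j in `I_(size (s k))) mball (y k j`_#i) (t * k.+1%:R^-1)) (x`_#i)] i].
  apply: ultra_forall_lt => k kn; have [j js jx] := nx k kn.
  suff : ultra_sets omega [set i | mdist (y k j`_#i) (x`_#i) < t * k.+1%:R^-1].
    by apply: filterS => i ji; exists j.
  apply: (ultralimit_dist_lt (d := fun i => mdist) (e := fun i => point)) => //.
  - by move=> *; exact: mdist_ge0.
  - by move=> *; exact: mdistxx.
  - by move=> *; exact: mdistC.
  - by move=> *; exact: mdist_triangle.
by apply: filterS => i.
Qed.

(** Three steps, each of which enlarges the neighbourhood by one mesh: from [K]
    to its first neighbourhood; from [mu] to a uniform measure on the ultralimit,
    whose atoms are those of an internal uniform measure; and from the latter to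
    [m].  The last two use [Wp_enlargement]. *)
Lemma near_measure n :
  ultra_sets omega [set i | (mu K <= (m`_#i) (@near_at n 3 i) + n.+1%:R^-1%:E)%E].
Proof.
have p0 : 0 < p by exact: lt_le_trans p1.
pose r : R := n.+1%:R^-1; have r0 : 0 < r by rewrite invr_gt0.
(* The choice of q makes each of the two uses of [Wp_enlargement] lose r / 2. *)
pose q := (r / 2) `^ p^-1; have q0 : 0 < q by rewrite powR_gt0// divr_gt0.
have qr0 : 0 < q * r by rewrite mulr_gt0.
have qE : (q * r) `^ p / r `^ p = r / 2.
  rewrite powRM ?ltW// mulfK ?gt_eqF ?powR_gt0//.
  by rewrite -powRrM mulVf ?gt_eqF// powRr1// ltW// divr_gt0.
have [N [x [mux mx]]] := am qr0.
have := Wp_enlargement p1 mux r0 (compact_borel cK) (mnear_hat n (1 + 1))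
  (fun a b Ka ab => near_hatS (@K_near n a Ka) ab).
rewrite qE => H1.
have tr : ultra_sets omega [set i | forall l, (l < N.+1)%N ->
    [set i | near_hat n (1 + 1) (st_hat (x l)) -> near_at n (1 + 1) (x l`_#i)] i].
  apply: ultra_forall_lt => l _.
  have [/near_transfer|nl] := pselect (near_hat n (1 + 1) (st_hat (x l))).
    by move=> nl; apply: filterS nl => i nl _.
  by apply: filterS filterT => i _ /nl.
apply: filterS (filterI mx tr) => i [/= mxi tri].
have H2 : (unif_hat p N x (near_hat n (1 + 1)) <= unif_at p N x i (@near_at n (1 + 1) i))%E.
  rewrite /unif_hat /unif_at !unifE; apply: lee_sum => l _.
  apply: lee_wpmul2l; first by rewrite lee_fin invr_ge0.
  rewrite !diracE lee_fin ler_nat.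
  have [|//] := boolP (st_hat (x l) \in near_hat n (1 + 1)).
  by rewrite inE => /(tri l (ltn_ord l)) nl; rewrite mem_set.
rewrite WpC// in mxi.
have := Wp_enlargement p1 mxi r0 (@mnear_at n (1 + 1) i) (@mnear_at n (1 + 1 + 1) i)
  (fun a b na ab => near_atS na ab).
rewrite qE => H3; have E3 : (1 + 1 + 1 : R) = 3 by ring.
rewrite E3 in H3.
apply: le_trans H1 _; apply: le_trans (leeD2r _ H2) _.
apply: le_trans (leeD2r _ H3) _.
by rewrite -addeA -EFinD -splitr.
Qed.

(** A point of [internal C] is infinitely close to the nets, hence at distance
    zero from the closed set [K]. *)
Lemma internal_in_net (C : forall i, set (X i)) (f : nat -> nat) :
  (forall i, (0 < f i)%N -> C i `<=` @near_at (f i).-1 3 i) ->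
  (forall k, ultra_sets omega [set i | (k <= f i)%N]) ->
  @internal R omega X C `<=` st_hat_preimage K.
Proof.
move=> Cf fk x /internal_urepr Cx.
have xy k : exists2 j, (j < size (s k))%N &
    ultra_sets omega [set i | mdist (y k j`_#i) (urepr x i) < 3 * k.+1%:R^-1].
  apply: (ultra_exists_lt (A := fun j =>
    [set i | mdist (y k j`_#i) (urepr x i) < 3 * k.+1%:R^-1])).
  apply: filterS (filterI Cx (fk k.+1)) => i [/= Ci ki].
  have fi : (0 < f i)%N by exact: leq_ltn_trans ki.
  have [|j js jx] := Cf i fi _ Ci k; first by rewrite /= prednK.
  by exists j.
have xlim : in_lim (fun i => @mdist R (X i)) (fun i => point) x.
  rewrite -(ureprK x); apply/in_limP; first by move=> *; exact: mdist_ge0.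
  have [j js jx] := xy 0%N.
  have : in_lim (fun i => @mdist R (X i)) (fun i => point) (uclass omega (urepr (sval (y 0%N j)))).
    by rewrite ureprK; exact: (proj2_sig (y 0%N j)).
  move=> /in_limP -[|r yr]; first by move=> *; exact: mdist_ge0.
  exists (r + 3 * 0.+1%:R^-1); apply: filterS (filterI yr jx) => i [/= yri jxi].
  by apply: le_trans (mdist_triangle _ (y 0%N j`_#i) _) _; rewrite lerD// ltW.
pose x' : limX := exist _ x xlim.
exists x' => //=; apply: contrapT => nKx.
have oK : open (~` K) by rewrite openC; apply: compact_closed => //; exact: metric_hausdorff.
move: oK; rewrite openE => /(_ (st_hat x') nKx); rewrite /interior => /nbhs_ballP[e /= e0 eK].
have [k ke] : exists k : nat, k.+1%:R^-1 < e / 3 by apply: inv_nat_lt; rewrite divr_gt0.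
have [j js jx] := xy k.
apply: (eK (nth point (s k) j)); last by apply: (@sK k); exact: mem_nth.
rewrite -mball_ball /mball/= -st_y mdistC.
apply: (@le_lt_trans _ _ (3 * k.+1%:R^-1)); last by rewrite mulrC -ltr_pdivlMr.
apply: (ultralimit_dist_le (d := fun i => mdist) (e := fun i => point)).
- by move=> *; exact: mdist_ge0.
- by move=> *; exact: mdistxx.
- by move=> *; exact: mdistC.
- by move=> *; exact: mdist_triangle.
- by apply: filterS jx => i /= /ltW.
Qed.

Lemma net_internal : exists C : forall i, set (X i),
  [/\ forall i, measurable (C i : set (borel (X i))),
      @internal R omega X C `<=` st_hat_preimage K &
      (mu K <= loeb_premeasure (fun i => m`_#i) (@internal R omega X C))%E].
Proof.
pose A n := [set i | (mu K <= (m`_#i) (@near_at n 3 i) + n.+1%:R^-1%:E)%E].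
have [|f [fA fk]] := @ultra_diagonal omega A; first exact: near_measure.
pose C i := @near_at (f i).-1 3 i.
have mC i : measurable (C i : set (borel (X i))) by exact: mnear_at.
exists C; split => //; first exact: (@internal_in_net C f (fun i _ x Cx => Cx) fk).
have fK : mu K \is a fin_num by apply: fin_num_measure; exact: compact_borel.
have fC i : (m`_#i) (C i) \is a fin_num by exact: fin_num_measure.
rewrite /loeb_premeasure internal_measureE// -(fineK fK) lee_fin.
apply/ler_addgt0Pr => e e0; have [k ke] := inv_nat_lt e0.
rewrite -lerBlDr.
have cv : fine ((m`_#i) (C i)) @[i --> ultra_sets omega] -->
    hst (uclass omega (fun i => fine ((m`_#i) (C i)))).
  apply: hst_class_cvg; apply/hfinite_class; exists 1.
  apply: filterS filterT => i _ /=; rewrite ger0_norm ?fine_ge0//.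
  by rewrite -lee_fin (fineK (fC i)); exact: probability_le1.
refine (ultra_le_cvg (cvg_cst _) cv _).
apply: filterS (fk k.+1) => i /= ki.
have fi : (0 < f i)%N by exact: leq_ltn_trans ki.
have H : (mu K <= (m`_#i) (C i) + (f i).-1.+1%:R^-1%:E)%E by apply: fA; rewrite ltn_predL.
rewrite -(fineK fK) -(fineK (fC i)) -EFinD lee_fin prednK// in H.
rewrite lerBlDr; apply: le_trans H _; rewrite lerD2l.
by apply: le_trans (ltW ke); rewrite lef_pV2 ?posrE ?ltr0n// ler_nat.
Qed.

End net.

(** The neighbourhoods of [near_measure] shrink to the preimage of [K] and have
    nearly the mass of [K]; a diagonal choice makes one internal set of them. *)
Lemma loeb_compact (K : set hatX) : compact K -> exists C : forall i, set (X i),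
  [/\ forall i, measurable (C i : set (borel (X i))),
      @internal R omega X C `<=` st_hat_preimage K &
      (mu K <= loeb_premeasure (fun i => m`_#i) (@internal R omega X C))%E].
Proof.
move=> cK.
have /choice[s sP] : forall k : nat, exists s : seq hatX, (forall x, x \in s -> K x) /\
    forall y, K y -> exists2 x, x \in s & mball x k.+1%:R^-1 y.
  by move=> k; apply: compact_net => //; rewrite invr_gt0.
apply: (@net_internal K cK s) => k; [exact: (sP k).1|exact: (sP k).2].
Qed.

End loeb_compact.

(** * The pushforward of the Loeb measure *)

Section loeb_pushforward.
Context {R : realType} (omega : free_ultrafilter) (X : nat -> pointedMetricType R) (p : R).
Hypothesis p1 : 1 <= p.

Local Notation hatX := (hat omega X).
Local Notation U := (uspace omega X).
Local Notation int := (@internal R omega X).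

Variables (mu : Pp hatX p) (m : Pp_lim omega X p).
Hypothesis am : approximates mu m.

Let nu i : probability (borel (X i)) R := urepr (sval m) i.
Let P : {measure set U -> \bar R} := @loeb_premeasure R omega X nu.
Let L := Loeb (sval m).

Let LP (A : set U) : measurable A -> L A = P A.
Proof. exact: measurable_mu_extE. Qed.

Let le_L (A B : set U) : A `<=` B -> (L A <= L B)%E.
Proof. exact: le_outer_measure. Qed.

Let PT : P setT = 1%E.
Proof.
have -> : [set: U] = int (fun=> setT).
  by apply/seteqP; split => // x _; apply/internal_urepr; exact: filterS filterT.
rewrite /P/= /loeb_premeasure internal_measureE//; congr EFin; apply: hst_cvg.
rewrite (_ : (fun _ => _) = fun=> 1); first exact: cvg_cst.
by apply/funext => i; rewrite probability_setT.
Qed.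

Let inner (B : set (borel hatX)) (e : R) : measurable B -> 0 < e ->
  exists C : set U, [/\ measurable C, C `<=` st_hat_preimage B & (mu B <= P C + e%:E)%E].
Proof.
move=> mB e0; have [K [cK KB muK]] := radon_compact (Pp_radon mu) mB e0.
have [C [mC CK KC]] := loeb_compact p1 am cK.
exists (int C); split.
- by exists C.
- by apply: subset_trans CK _ => _ [x Kx <-]; exists x => //; exact: KB.
- by apply: le_trans muK _; exact: leeD2r.
Qed.

Let PC (C : set U) : measurable C -> P (~` C) = (1 - P C)%E.
Proof.
move=> mC; have fC : P C \is a fin_num by [].
rewrite -PT -(setUv C) measureU ?setICr//; last exact: measurableC.
by rewrite addeAC subee// add0e.
Qed.

Lemma Loeb_concentrated : concentrated_on_lim (Loeb (sval m)).
Proof.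
apply/eqP; rewrite eq_le outer_measure_ge0 andbT; apply/lee_addgt0Pr => e e0.
have [C [mC CT CP]] := inner measurableT e0.
rewrite add0e; apply: (@le_trans _ _ (L (~` C))).
  apply: le_L; apply: subsetC => x /CT[y _ <-].
  by exists y.
have muT : mu setT = 1%E by exact: (@probability_setT _ _ _ (Pp_prob mu)).
rewrite LP; last exact: measurableC.
by rewrite PC// leeBlDl// -muT.
Qed.

Let preimage_disj (B : set hatX) : st_hat_preimage (~` B) `<=` ~` st_hat_preimage B.
Proof.
move=> _ [x nBx <-] [y By xy]; apply: nBx; move: By; congr B; congr st_hat.
by case: x y xy => [x xl] [y yl] /= xy; rewrite xy in yl *; congr exist; exact: Prop_irrelevance.
Qed.

(** Compact sets inside [B] and inside its complement give internal sets [C] and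
    [C'] inside the preimage of [B] and inside its complement, which together
    miss only a set of measure [e].  Internal sets are measurable, so the preimage
    of [B] is measurable up to [e] as well. *)
Lemma Loeb_pushforward : st_hat_pushforward (Loeb (sval m)) mu.
Proof.
move=> B mB; set S := st_hat_preimage B.
have mBC : measurable (~` B) by exact: measurableC.
have muBC : (mu (~` B) = 1 - mu B)%E.
  exact: (@probability_setC _ _ _ (Pp_prob mu)).
have fB : mu B \is a fin_num by exact: fin_num_measure.
have sandwich e : 0 < e -> exists C C' : set U,
    [/\ measurable C /\ measurable C', C `<=` S, C' `<=` ~` S,
        (mu B <= P C + e%:E)%E & (1 - mu B <= P C' + e%:E)%E].
  move=> e0; have [C [mC CS CP]] := inner mB e0.
  have [C' [mC' CS' CP']] := inner mBC e0.
  exists C, C'; split => //; last by rewrite -muBC.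
  by apply: subset_trans CS' _; exact: preimage_disj.
split; last first.
  apply/eqP; rewrite eq_le; apply/andP; split; apply/lee_addgt0Pr => e e0;
    have [C [C' [[mC mC'] CS CS' CP CP']]] := sandwich e e0.
    have SC : S `<=` ~` C' by move=> x Sx /CS'.
    apply: le_trans (le_L SC) _; rewrite LP; last exact: measurableC.
    have fC' : P C' \is a fin_num by [].
    rewrite PC//; move: CP'; rewrite -(fineK fB) -(fineK fC').
    by rewrite -!EFinB -!EFinD !lee_fin; lra.
  apply: le_trans CP _; apply: leeD2r; rewrite -LP//; exact: le_L.
apply: le_caratheodory_measurable => A.
apply/lee_addgt0Pr => e e0; have e2 : 0 < e / 2 by rewrite divr_gt0.
have [C [C' [[mC mC'] CS CS' CP CP']]] := sandwich _ e2.
have fC : P C \is a fin_num by [].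
have fC' : P C' \is a fin_num by [].
have mCC : measurable (~` (C `|` C')) by apply: measurableC; exact: measurableU.
have rest : (L (~` (C `|` C')) <= e%:E)%E.
  rewrite LP// PC; last exact: measurableU.
  have -> : (P (C `|` C') = P C + P C')%E.
    rewrite measureU//; apply/seteqP; split => // x [/CS Sx /CS'].
    exact.
  move: CP CP'; rewrite -(fineK fB) -(fineK fC) -(fineK fC').
  by rewrite -!EFinB -!EFinD !lee_fin; lra.
have cC : caratheodory_measurable L C by exact: caratheodory_measurable_mu_ext.
rewrite (cC A) addeAC; apply: leeD; last first.
  by apply: le_L => x [Ax nSx]; split => // /CS.
apply: (@le_trans _ _ (L ((A `&` C) `|` ~` (C `|` C')))).
  apply: le_L => x [Ax Sx]; have [Cx|nCx] := pselect (C x); [by left|right].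
  by move=> [//|/CS'].
by apply: le_trans (outer_measureU2 _ _ _) _; exact: leeD2l.
Qed.

End loeb_pushforward.

Theorem theorem17 (R : realType) (omega : free_ultrafilter) (p : R)
    (X : nat -> pointedMetricType R) (mu : Pp (hat omega X) p) :
  1 <= p ->
  exists muw : Pp_lim omega X p,
    [/\ lifting mu muw,
        hyperfinite (sval muw),
        concentrated_on_lim (Loeb (sval muw))
      & st_hat_pushforward (Loeb (sval muw)) mu].
Proof.
move=> p1; have [m am hm] := approximates_exists p1 mu.
exists m; split => //.
- exact: approximates_lifting.
- exact: Loeb_concentrated am.
- exact: Loeb_pushforward.
Qed.
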